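(* Let $0<p<q\le1$ and let $K\subset\mathbb{R}^n$ be a convex body. Then $$\frac{2}{\pi}\,\mathrm{Vol}_n(K)^{\frac1p-\frac1q}F_qK\subset F_pK\subset\mathrm{Vol}_n(K)^{\frac1p-\frac1q}F_qK.$$
   Context: A convex body is a compact convex set with non-empty interior. For $p>0$ the Fourier $p$th mean body $F_pK$ is the origin-symmetric star-shaped set $\{t\theta:\theta\in\mathbb{S}^{n-1},\,0\le t<\infty,\,t\le\rho_{F_pK}(\theta)\}$ with radial function $$\rho_{F_pK}(\theta)=\left(\frac{p}{\mathrm{Vol}_n(K)}\int_0^\infty|\widehat{\chi_K}(r\theta)|^2r^{p-1}dr\right)^{1/p},\quad\theta\in\mathbb{S}^{n-1},$$ where $\chi_K$ is the indicator function of $K$ and $\hat f(y)=\int_{\mathbb{R}^n}e^{-i\langle x,y\rangle}f(x)dx$. *)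

(* Defs.v *)
From HB Require Import structures.
From mathcomp Require Import all_boot all_order all_algebra.
From mathcomp Require Import all_classical all_reals all_analysis.
From mathcomp Require Import complex.

Set Implicit Arguments.
Unset Strict Implicit.
Unset Printing Implicit Defensive.

Import Order.TTheory GRing.Theory Num.Theory.
Import numFieldNormedType.Exports.

Local Open Scope classical_set_scope.
Local Open Scope ring_scope.

(* [R^n] is ['rV[R]_n]; its topology comes from the sup norm of the library,
   the Euclidean structure is given by [dotv] and [enorm]. *)

Section measurable_rV.
Context {d} {T : measurableType d}.
Variable n : nat.

Let coord : 'I_n -> 'rV[T]_n -> T := fun i x => x ord0 i.

Let rV_set0 : g_sigma_preimage coord set0.
Proof. exact: sigma_algebra0. Qed.

Let rV_setC A : g_sigma_preimage coord A -> g_sigma_preimage coord (~` A).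
Proof. exact: sigma_algebraC. Qed.

Let rV_bigcup (F : (set 'rV[T]_n)^nat) :
  (forall i, g_sigma_preimage coord (F i)) ->
  g_sigma_preimage coord (\bigcup_i (F i)).
Proof. exact: sigma_algebra_bigcup. Qed.

(* The product sigma-algebra (for [T := R], the Borel sets of [R^n]). *)
HB.instance Definition _ := @isMeasurable.Build (measure_tuple_display d)
  'rV[T]_n (g_sigma_preimage coord) rV_set0 rV_setC rV_bigcup.

End measurable_rV.

Lemma measurable_fun_rVP d1 d2 (T1 : measurableType d1) (T2 : measurableType d2)
    n (f : T1 -> 'rV[T2]_n) :
  (forall i, measurable_fun [set: T1] (fun x => f x ord0 i)) ->
  measurable_fun [set: T1] f.
Proof.
move=> mf _ A mA; rewrite setTI.
suff : g_sigma_preimage (fun i => (fun x : 'rV[T2]_n => x ord0 i) \o f)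
    `<=` measurable.
  by apply; rewrite g_sigma_preimage_comp; exists A => //; rewrite setTI.
apply: smallest_sub; first exact: sigma_algebra_measurable.
case: n => [|n] in f mf A mA *; first by rewrite big_ord0.
rewrite -bigcup_mkord_ord; apply: bigcup_sub => i Ii.
by move=> B [C mC <-]; exact: mf.
Qed.

Lemma measurable_rV_coord d (T : measurableType d) n (i : 'I_n) :
  measurable_fun [set: 'rV[T]_n] (fun x => x ord0 i).
Proof.
move=> _ Y mY; rewrite setTI; apply: sub_sigma_algebra => /=.
rewrite -bigcup_seq/=; exists i => /=; first by rewrite mem_index_enum.
by exists Y => //; rewrite setTI.
Qed.

Section lebesgue_rV.
Context {R : realType}.

Definition rV_cons n (p : R * 'rV[R]_n) : 'rV[R]_n.+1 :=
  \row_i oapp (p.2 ord0) p.1 (unlift ord0 i).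

Definition rV_uncons n (x : 'rV[R]_n.+1) : R * 'rV[R]_n :=
  (x ord0 ord0, \row_i x ord0 (lift ord0 i)).

Lemma rV_consK n : cancel (@rV_cons n) (@rV_uncons n).
Proof.
move=> [a x]; rewrite /rV_uncons /rV_cons mxE unlift_none /=; congr pair.
by apply/rowP => i; rewrite !mxE liftK.
Qed.

Lemma rV_unconsK n : cancel (@rV_uncons n) (@rV_cons n).
Proof.
move=> x; apply/rowP => i; rewrite mxE.
by case: unliftP => [j|] -> //=; rewrite mxE.
Qed.

Lemma measurable_rV_cons n : measurable_fun [set: R * 'rV[R]_n] (@rV_cons n).
Proof.
apply: measurable_fun_rVP => i; under eq_fun do rewrite mxE.
case: unliftP => [j _|_] /=; last exact: measurable_fst.
exact: (measurableT_comp (measurable_rV_coord j) measurable_snd).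
Qed.

Lemma measurable_rV_uncons n :
  measurable_fun [set: 'rV[R]_n.+1] (@rV_uncons n).
Proof.
apply: measurable_fun_pair; first exact: measurable_rV_coord.
apply: measurable_fun_rVP => i; under eq_fun do rewrite mxE.
exact: measurable_rV_coord.
Qed.

Section step.
Local Open Scope ereal_scope.
Variables (n : nat) (mu : {sigma_finite_measure set 'rV[R]_n -> \bar R}).

Definition lebesgue_rV_step : set 'rV[R]_n.+1 -> \bar R :=
  pushforward (@lebesgue_measure R \x mu) (@rV_cons n).

Let measurable_preimage_cons (A : set 'rV[R]_n.+1) :
  measurable A -> measurable (@rV_cons n @^-1` A).
Proof. by move=> mA; rewrite -[_ @^-1` _]setTI; exact: measurable_rV_cons. Qed.

Let step0 : lebesgue_rV_step set0 = 0.
Proof. by rewrite /lebesgue_rV_step /pushforward preimage_set0 measure0. Qed.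

Let step_ge0 A : 0 <= lebesgue_rV_step A.
Proof. by rewrite /lebesgue_rV_step /pushforward; apply: measure_ge0. Qed.

Let step_sigma_additive : semi_sigma_additive lebesgue_rV_step.
Proof.
move=> F mF tF mUF; rewrite /lebesgue_rV_step /pushforward preimage_bigcup.
apply: measure_semi_sigma_additive.
- by move=> i; exact: measurable_preimage_cons.
- apply/trivIsetP => i j _ _ ij; rewrite -preimage_setI.
  by move/trivIsetP : tF => /(_ _ _ _ _ ij) ->//; rewrite preimage_set0.
- by rewrite -preimage_bigcup; exact: measurable_preimage_cons.
Qed.

HB.instance Definition _ := isMeasure.Build _ _ _
  lebesgue_rV_step step0 step_ge0 step_sigma_additive.

(* The library's instance for [\x] only fires on subprobabilities. *)
Let step_sigma_finite : sigma_finite setT lebesgue_rV_step.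
Proof.
have /sigma_finiteP[F [TF ndF Foo]] := sigma_finiteT (@lebesgue_measure R).
have /sigma_finiteP[G [TG ndG Goo]] := sigma_finiteT mu.
exists (fun k => @rV_uncons n @^-1` (F k `*` G k)).
  rewrite -preimage_bigcup -[LHS](preimage_setT (@rV_uncons n)); congr preimage.
  rewrite -setXTT TF TG predeqE => -[x y]; split => /=.
    move=> [[i _ Fix] [j _ Gjy]]; exists (maxn i j) => //; split.
    - by move: x Fix; exact/subsetPset/ndF/leq_maxl.
    - by move: y Gjy; exact/subsetPset/ndG/leq_maxr.
  by move=> [i _ [/= ? ?]]; split; exists i.
move=> k; have [mF Fk] := Foo k; have [mG Gk] := Goo k; split.
  rewrite -[_ @^-1` _]setTI; apply: measurable_rV_uncons => //.
  exact: measurableX.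
rewrite /lebesgue_rV_step /pushforward -comp_preimage.
rewrite (_ : _ \o _ = id) ?preimage_id; last first.
  by apply/funext => z; exact: rV_consK.
by rewrite product_measure1E// lte_mul_pinfty// ge0_fin_numE.
Qed.

HB.instance Definition _ :=
  @Measure_isSigmaFinite.Build _ _ _ lebesgue_rV_step step_sigma_finite.

End step.

(* [R^0] is a point, of mass 1, and the measure on [R^n.+1] is the product of
   the Lebesgue measures on [R] and [R^n]. *)
Fixpoint lebesgue_rV n : {sigma_finite_measure set 'rV[R]_n -> \bar R} :=
  if n is m.+1 then lebesgue_rV_step (lebesgue_rV m) else \d_ (0 : 'rV[R]_0).

End lebesgue_rV.
Arguments lebesgue_rV {R} n.

Section mean_bodies.
Context {R : realType}.
Local Open Scope complex_scope.

Section euclidean.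
Variable n : nat.
Implicit Types x y : 'rV[R]_n.

Definition dotv x y : R := \sum_(i < n) x ord0 i * y ord0 i.

Definition enorm x : R := Num.sqrt (dotv x x).

Definition convex_body (K : set 'rV[R]_n) : Prop :=
  [/\ compact K, @convex_set R 'rV[R]_n K & K° !=set0].

(* Real-valued; only meaningful for sets of finite measure. *)
Definition vol (K : set 'rV[R]_n) : R := fine (lebesgue_rV n K).

End euclidean.

Definition cintegral d (T : measurableType d) (mu : {measure set T -> \bar R})
    (D : set T) (f : T -> R[i]) : R[i] :=
  (\int[mu]_(x in D) complex.Re (f x)) +i* (\int[mu]_(x in D) complex.Im (f x)).

(* [e^(i t)] *)
Definition expi (t : R) : R[i] := cos t +i* sin t.

Definition fourier n (f : 'rV[R]_n -> R[i]) (y : 'rV[R]_n) : R[i] :=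
  cintegral (lebesgue_rV n) [set: 'rV[R]_n] (fun x => expi (- dotv x y) * f x).

Section mean_body.
Variables (n : nat) (p : R) (K : set 'rV[R]_n).

(* Extended-real valued, as the integral is not known a priori to converge. *)
Definition fourier_mean_radial (theta : 'rV[R]_n) : \bar R :=
  (((p / vol K)%:E * \int[@lebesgue_measure R]_(r in `]0%R, +oo[)
      ((Normc.normc (fourier (fun x => (\1_K x)%:C) (r *: theta)) ^+ 2
        * r `^ (p - 1))%R)%:E) `^ p^-1)%E.

Definition fourier_mean_body : set 'rV[R]_n :=
  [set x | exists theta t, [/\ enorm theta = 1, 0 <= t,
    (t%:E <= fourier_mean_radial theta)%E & x = t *: theta]].

End mean_body.

End mean_bodies.

(* Main.v *)
(* The radial function depends only on phi(r) = |F chi_K(r theta)|^2, which is the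
   cosine transform of the law lam of <x - y, theta>, x and y independent in K;
   put m = phi(0) = Vol(K)^2.  The right inclusion uses only 0 <= phi <= m: among
   such functions with a given p-th moment, m 1_[0,T] has the smallest q-th one.
   This also reduces the left inclusion to q = 1.  There, the Prékopa-Leindler
   inequality makes lam log-concave; lam being symmetric, for every u > 0 it is
   concentrated at least as much as the two-sided exponential law of rate
   a = lam(]-u,u[) / (m u):  lam(]-t,t[) >= m (1 - exp(-a t)) for all t > 0.
   For every s > 0 the Laplace transform of phi at s is the integral against lam
   of the kernel s / (s^2 + z^2), which decreases in |z|; hence it dominates the
   Laplace transform of m a^2 / (a^2 + r^2), the cosine transform of the
   exponential law.  As r^(p-1) is a mixture of the functions exp(-s r), the p-th
   moment of phi is at least m a^p / p.  On the other hand, if A bounds every a,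
   so that lam(]-u,u[) <= m A u, the same kernel, of integral pi/2 over the half
   line, gives int phi <= m A pi / 2, whence the constant 2 / pi. *)

Require Import Defs.
From mathcomp Require Import all_boot all_order all_algebra.
From mathcomp Require Import all_classical all_reals all_analysis.
From mathcomp Require Import complex measurable_realfun ring lra.

Set Implicit Arguments.
Unset Strict Implicit.
Unset Printing Implicit Defensive.

Import Order.TTheory GRing.Theory Num.Theory.
Import numFieldNormedType.Exports.

Local Open Scope classical_set_scope.
Local Open Scope ring_scope.
Local Open Scope complex_scope.

(** * Midpoint Brunn-Minkowski and Prékopa-Leindler inequalities on the line *)

(** Log-concavity of [lam] is used for sets and midpoints only: [lam A * lam B <= lam C * lam C]
    when [C] contains the midpoints of [A] and [B]. No density of [lam] is produced. Two
    consequences give the exponential comparison: an interval has at most the mass of the centred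
    one of the same length, and the two-sided tail 1 - Phi(t), with Phi(t) = lam(]-t,t[) / m, is at
    most the square of its value at t / 2. Iterating the halving creates the exponential.
    Integrability of phi is not known in advance, and the cosine has no sign. The kernel is
    therefore 1 + cos: every exchange of integrals is Tonelli's theorem in the extended reals, and
    the 1 contributes the same finite term to both sides, which is then cancelled. The volume
    factors are scaling. With V = Vol(K) and T = t V^(-1/p), t is at most the radial function of
    F_pK exactly when the p-th moment of phi is at least m T^p / p, that of m 1_[0,T]. The factor
    V^(1/p - 1/q) makes T the same for p and q, so moments of a single function are compared. *)

Lemma measure_mono d (T : measurableType d) (R : realType)
    (mu : {measure set T -> \bar R}) (A B : set T) :
  measurable A -> measurable B -> A `<=` B -> (mu A <= mu B)%E.
Proof. by move=> mA mB AB; apply: le_measure; rewrite ?inE. Qed.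

Section lebesgue_affine.
Local Open Scope ereal_scope.
Context {R : realType}.
Local Notation mu := (@lebesgue_measure R).

Lemma lebesgue_measure_affine (c b : R) (A : set R) : (0 < c)%R ->
  measurable A -> c%:E * mu ((fun x => c * x + b)%R @^-1` A) = mu A.
Proof.
move=> c0 mA.
pose c' : {nonneg R} := NngNum (ltW c0).
pose f : R -> measurableTypeR R := (fun x => c * x + b)%R.
have mf : measurable_fun [set: R] f.
  by apply: measurable_funD => //; exact: measurable_funM.
pose nu : {measure set (measurableTypeR R) -> \bar R} :=
  mscale c' (pushforward mu f).
apply/esym; rewrite -[LHS]/(mu A) -[RHS]/(nu mf A).
apply: lebesgue_measure_unique => // _ [[u v]/= _ <-].
rewrite /nu/= /mscale/= /pushforward.
have -> : f @^-1` `]u, v]%classic = `](u - b) / c, (v - b) / c]%classic%R.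
  apply/seteqP; split => x; rewrite /= !in_itv/= /f ler_pdivlMr// ltr_pdivrMr//.
    by move=> /andP[? ?]; apply/andP; split; lra.
  by move=> /andP[? ?]; apply/andP; split; lra.
rewrite !lebesgue_measure_itv/= !lte_fin ltr_pM2r ?invr_gt0// ltrD2r.
case: ifP => uv; last by rewrite mule0.
by rewrite -!EFinB -EFinM; congr EFin; field; exact: lt0r_neq0.
Qed.

(** The sets A ∩ ]-oo,x[, with x increasing to sup A, exhaust A up to the supremum itself if it is
    attained, and a point has measure zero. In [brunn_minkowski_itv] this stands in for an
    approximation by compact sets. *)
Lemma lebesgue_measure_below_le (A : set R) (X : \bar R) : measurable A ->
  (0 <= X) -> (forall a, A a -> mu (A `&` `]-oo, a[) <= X) -> mu A <= X.
Proof.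
move=> mA X0 AX.
(* [s] is the one point of [A] that the rays may all miss: the supremum if [A] is non-empty and
   bounded above, a dummy value otherwise. *)
suff [x [s [xi xA xs]]] : exists (x : R^nat) s, [/\ nondecreasing_seq x,
    forall n, mu (A `&` `]-oo, x n[) <= X &
    forall a, A a -> a <> s -> exists n, (a < x n)%R].
  pose F n := A `&` `]-oo, x n[.
  have FS m n : (m <= n)%N -> F m `<=` F n.
    move=> mn; apply: setIS.
    by apply: subset_itvl; rewrite bnd_simp; exact: xi.
  have mF n : measurable (F n) by exact: measurableI.
  have FX : mu (\bigcup_n F n) <= X.
    have /cvg_lim <- // : mu (F n) @[n --> \oo] --> mu (\bigcup_n F n).
      apply: nondecreasing_cvg_mu => //; first exact: bigcupT_measurable.
      by move=> m n mn; apply/subsetPset; exact: FS.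
    apply: lime_le; last by apply: nearW => n; exact: xA.
    apply: ereal_nondecreasing_is_cvgn => m n mn; apply: measure_mono;
      by [exact: mF|exact: FS].
  rewrite (le_trans _ FX)//.
  apply: (@le_trans _ _ (mu (\bigcup_n F n `|` [set s]))).
    apply: measure_mono => //.
      by apply: measurableU => //; exact: bigcupT_measurable.
    move=> a Aa; have [->|as_] := pselect (a = s); [by right|left].
    by have [n ?] := xs a Aa as_; exists n => //; split => //=; rewrite in_itv.
  apply: (le_trans (measureU2 _ _ _)) => //; first exact: bigcupT_measurable.
  by rewrite [X in _ + X]lebesgue_measure_set1 adde0.
have below_le y : (exists2 a, A a & (y <= a)%R) -> mu (A `&` `]-oo, y[) <= X.
  move=> [a Aa ya]; apply: le_trans (AX a Aa).
  apply: measure_mono; [exact: measurableI..|].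
  by apply: setIS; apply: subset_itvl; rewrite bnd_simp.
have [A0|A0] := pselect (A !=set0); last first.
  exists (cst 0%R), 0%R; split => [//|n|a Aa]; last by case: A0; exists a.
  suff -> : A `&` `]-oo, cst 0%R n[ = set0 by rewrite measure0.
  by rewrite -subset0 => a [Aa _]; case: A0; exists a.
have [uA|uA] := pselect (has_ubound A).
  have sA : has_sup A by split.
  exists (fun n => sup A - n.+1%:R^-1)%R, (sup A); split.
  - by move=> m n mn; rewrite lerD2l lerN2 lef_pV2 ?posrE// ler_nat.
  - move=> n; apply: below_le.
    have [|a Aa /ltW ?] := @sup_adherent _ A (n.+1%:R^-1) _ sA; first by [].
    by exists a.
  - move=> a Aa /eqP as_; have as' : (0 < sup A - a)%R.
      by rewrite subr_gt0 lt_neqAle as_ ub_le_sup.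
    have [n _ /(_ n (leqnn n)) /= H] := near_infty_natSinv_lt (PosNum as').
    by exists n; rewrite ltrBrDr addrC -ltrBrDr.
exists (fun n => n%:R)%R, 0%R; split.
- by move=> m n mn; rewrite ler_nat.
- move=> n; apply: below_le; apply: contrapT => /forallPNP H; apply: uA.
  by exists n%:R%R => a Aa; have /negP := H a Aa; rewrite -ltNge => /ltW.
- move=> a Aa _; exists (Num.trunc `|a|%R).+1.
  by rewrite (le_lt_trans (ler_norm a))// truncnS_gt.
Qed.

End lebesgue_affine.

Section brunn_minkowski.
Local Open Scope ereal_scope.
Context {R : realType}.
Local Notation mu := (@lebesgue_measure R).

Lemma lebesgue_measure_above_le (A : set R) (X : \bar R) : measurable A ->
  0 <= X -> (forall a, A a -> mu (A `&` `]a, +oo[) <= X) -> mu A <= X.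
Proof.
move=> mA X0 AX; pose N := -%R : R -> measurableTypeR R.
have mN (B : set R) : measurable B -> measurable (N @^-1` B).
  by move=> mB; rewrite -[X in measurable X]setTI; exact: oppr_measurable.
rewrite -lebesgue_measureN//; apply: lebesgue_measure_below_le => //.
  exact: mN.
move=> a /AX; rewrite -lebesgue_measureN; last exact: measurableI.
congr (mu _ <= _); rewrite -/N; apply/seteqP; split => x /=;
  rewrite !in_itv/= andbT ltrNr ?opprK//.
Qed.

(** For a in A, b in B and c = (a + b) / 2, the midpoints of b with the part of A left of a lie in C
    left of c; those of a with the part of B right of b lie in C right of c. These pieces are
    disjoint and scaled by 1/2, whence [split_le]. Suprema over b and a conclude. *)
Lemma brunn_minkowski_itv (A B C : set R) : measurable A -> measurable B ->
  measurable C -> A !=set0 -> B !=set0 ->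
  (forall x y, A x -> B y -> C ((x + y) / 2)%R) -> mu A + mu B <= 2%:E * mu C.
Proof.
move=> mA mB mC [a0 Aa0] [b0 Bb0] ABC.
have half (D : set R) (c : R) : measurable D ->
    mu ((fun x => 2^-1 * x + c)%R @^-1` D) = 2%:E * mu D.
  move=> mD; rewrite -(@lebesgue_measure_affine _ 2^-1 c D)//.
  by rewrite muleA -EFinM divff// mul1e.
have split_le a b : A a -> B b ->
    mu (A `&` `]-oo, a[) + mu (B `&` `]b, +oo[) <= 2%:E * mu C.
  move=> Aa Bb; set c := ((a + b) / 2)%R.
  have mC1 : measurable (C `&` `]-oo, c[) by exact: measurableI.
  have mC2 : measurable (C `&` `]c, +oo[) by exact: measurableI.
  have mf (D : set R) (e : R) : measurable D ->
      measurable ((fun x : R => 2^-1 * x + e)%R @^-1` D).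
    move=> mD; rewrite -[X in measurable X]setTI.
    by apply: measurable_funD => //; exact: measurable_funM.
  apply: (@le_trans _ _ (2%:E * (mu (C `&` `]-oo, c[) + mu (C `&` `]c, +oo[)))).
    rewrite muleDr ?ge0_adde_def ?inE//.
    rewrite -(half _ (b / 2)%R mC1) -(half _ (a / 2)%R mC2).
    apply: leeD.
    - apply: measure_mono; [exact: measurableI|exact: mf|].
      move=> x [Ax]; rewrite /= !in_itv/= => xa; split; last by rewrite /c; lra.
      by rewrite mulrC -mulrDl; exact: ABC.
    - apply: measure_mono; [exact: measurableI|exact: mf|].
      move=> x [Bx]; rewrite /= !in_itv/= !andbT => xb.
      split; last by rewrite /c; lra.
      by rewrite mulrC -mulrDl addrC; exact: ABC.
  rewrite lee_pmul2l// -measureU//; last first.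
    rewrite -subset0 => x [[_ /=]]; rewrite in_itv/= => xc [_].
    by rewrite /= in_itv/= andbT => /(lt_trans xc); rewrite ltxx.
  by apply: measure_mono => //; [exact: measurableU|move=> x [] []].
(* An infinite measure of [C] is trivial. A finite one makes the subtractions legitimate that let
   [b] run first, with [a] fixed, and then [a]. *)
have [->|Yfin] := eqVneq (2%:E * mu C) +oo; first by rewrite leey.
have Y0 : 0 <= 2%:E * mu C by exact: mule_ge0.
have {}Yfin : 2%:E * mu C \is a fin_num by rewrite ge0_fin_numE// ltey.
have A1B a : A a -> mu (A `&` `]-oo, a[) + mu B <= 2%:E * mu C.
  move=> Aa; have A1fin : mu (A `&` `]-oo, a[) \is a fin_num.
    rewrite ge0_fin_numE//; apply: le_lt_trans (_ : 2%:E * mu C < +oo).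
      by apply: le_trans (split_le _ _ Aa Bb0); rewrite leeDl.
    by rewrite -ge0_fin_numE.
  rewrite addeC -leeBrDr//; apply: lebesgue_measure_above_le => //.
    rewrite sube_ge0 ?A1fin//.
    by apply: le_trans (split_le _ _ Aa Bb0); rewrite leeDl.
  by move=> b Bb; rewrite leeBrDr// addeC; exact: split_le.
have Bfin : mu B \is a fin_num.
  rewrite ge0_fin_numE//; apply: le_lt_trans (_ : 2%:E * mu C < +oo).
    by apply: le_trans (A1B _ Aa0); rewrite leeDr.
  by rewrite -ge0_fin_numE.
rewrite -leeBrDr//; apply: lebesgue_measure_below_le => //.
  rewrite sube_ge0 ?Bfin//.
  by apply: le_trans (A1B _ Aa0); rewrite leeDr.
by move=> a Aa; rewrite leeBrDr//; exact: A1B.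
Qed.

End brunn_minkowski.

Section layer_cake.
Local Open Scope ereal_scope.
Context d (T : measurableType d) (R : realType).
Variable mu : {sigma_finite_measure set T -> \bar R}.

Lemma measurable_subgraph (f : T -> R) : measurable_fun setT f ->
  measurable [set p : T * measurableTypeR R | 0 < p.2 < f p.1]%R.
Proof.
move=> mf; set E := [set _ | _].
rewrite (_ : E = (setT `&` [set p | 0 < p.2]%R) `&`
    (setT `&` [set p | p.2 < f p.1]%R)); last first.
  rewrite !setTI /E; apply/seteqP; split => p /=; first by move=> /andP[].
  by move=> [-> ->].
have mfst : measurable_fun [set: T * measurableTypeR R] (f \o fst).
  exact: measurableT_comp.
have mlt (u v : T * measurableTypeR R -> R) : measurable_fun setT u ->
    measurable_fun setT v -> measurable (setT `&` [set p | u p < v p]%R).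
  move=> mu_ mv; have := measurable_fun_ltr mu_ mv measurableT.
  by move=> /(_ [set true]); exact.
by apply: measurableI; apply: mlt => //; exact: measurable_snd.
Qed.

Lemma measurable_layer (f : T -> R) (w : T -> \bar R) :
  measurable_fun setT f -> measurable_fun setT w -> (forall x, 0 <= w x) ->
  measurable_fun [set: R] (fun y : R =>
    \int[mu]_x ((\1_[set x | 0 < y < f x]%R x)%:E * w x)).
Proof.
move=> mf mw w0.
have mE := measurable_subgraph mf; set E := [set _ | _] in mE.
apply: (@measurable_fun_fubini_tonelli_G _ _ _ _ _ mu
  (fun p => (\1_E p)%:E * w p.1)).
- apply: emeasurable_funM; last exact: measurableT_comp.
  by apply/measurable_EFinP; exact: measurable_indic.
- by move=> p; apply: mule_ge0 => //; rewrite lee_fin.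
Qed.

(** Tonelli applied to f(x) = length of ]0,f(x)[. The weight [w] allows a density to be kept as a
    function: later [lam] with weight one is compared with weighted Lebesgue measure. *)
Lemma layer_cake (f : T -> R) (w : T -> \bar R) :
  measurable_fun setT f -> measurable_fun setT w ->
  (forall x, 0 <= f x)%R -> (forall x, 0 <= w x) ->
  \int[mu]_x ((f x)%:E * w x) =
  \int[@lebesgue_measure R]_y
    \int[mu]_x ((\1_[set x | 0 < y < f x]%R x)%:E * w x).
Proof.
move=> mf mw f0 w0.
have mE := measurable_subgraph mf; set E := [set _ | _] in mE.
rewrite -(@fubini_tonelli _ _ _ _ _ _ _ (fun p => (\1_E p)%:E * w p.1)); last 2 first.
- apply: emeasurable_funM; last exact: measurableT_comp.
  by apply/measurable_EFinP; exact: measurable_indic.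
- by move=> p; apply: mule_ge0 => //; rewrite lee_fin.
apply: eq_integral => x _ /=.
rewrite ge0_integralZr//; last first.
  apply/measurable_EFinP.
  apply: (measurableT_comp (measurable_indic mE)).
  exact: pair1_measurable.
congr (_ * _).
apply/esym; transitivity (\int[@lebesgue_measure R]_y (\1_`]0%R, f x[ y)%:E).
  apply: eq_integral => y _; rewrite !indicE.
  suff -> : ((x, y) \in E) = (y \in `]0%R, f x[%classic) by [].
  by apply/idP/idP; rewrite !inE/= ?in_itv.
rewrite integral_indic//= setIT lebesgue_measure_itv/= lte_fin.
case: ltP => [_|fx0]; first by rewrite sube0.
by congr EFin; apply/eqP; rewrite eq_le f0 fx0.
Qed.

End layer_cake.

Section prekopa_leindler.
Local Open Scope ereal_scope.

(* Squared, so that no square root of an extended real is needed; [mid] is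
   the midpoint operation, which makes the property stable under products. *)
Definition prekopa_leindler d (T : measurableType d) (R : realType)
    (mid : T -> T -> T) (mu : {measure set T -> \bar R}) :=
  forall f g h : T -> \bar R,
    measurable_fun setT f -> measurable_fun setT g -> measurable_fun setT h ->
    (forall x, 0 <= f x) -> (forall x, 0 <= g x) -> (forall x, 0 <= h x) ->
    (forall x y, f x * g y <= h (mid x y) * h (mid x y)) ->
    (\int[mu]_x f x) * (\int[mu]_x g x) <= (\int[mu]_x h x) * (\int[mu]_x h x).

Context {R : realType}.
Local Notation mu := (@lebesgue_measure R).

Let layer1 (f : R -> R) : measurable_fun [set: R] f -> (forall x, 0 <= f x)%R ->
  \int[mu]_x (f x)%:E = \int[mu]_y mu [set x | 0 < y < f x]%R /\
  measurable_fun [set: R] (fun y : R => mu [set x | 0 < y < f x]%R).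
Proof.
move=> mf f0.
have mcst : measurable_fun [set: R] (cst 1%E : R -> \bar R) by [].
have E y : \int[mu]_x ((\1_[set x | 0 < y < f x]%R x)%:E * 1) =
    mu [set x | 0 < y < f x]%R.
  under eq_integral do rewrite mule1.
  rewrite integral_indic ?setIT//.
  have [y0|y0] := ltP 0%R y; last first.
    by rewrite [X in measurable X](_ : _ = set0)// -subset0 => x.
  have := measurable_fun_ltr (@measurable_cst _ _ _ _ [set: R] y) mf measurableT.
  by move=> /(_ [set true] I); rewrite setTI.
split.
  transitivity (\int[mu]_x ((f x)%:E * cst 1 x)).
    by apply: eq_integral => x _; rewrite mule1.
  etransitivity; first exact: (layer_cake mu mf mcst f0).
  by apply: eq_integral => y _; exact: E.
under eq_fun do rewrite -E.
exact: (measurable_layer mu mf mcst (fun=> lee01)).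
Qed.

(** Brunn-Minkowski is applied to the level sets at each height y and the result is integrated in y.
    It requires non-empty sets: supremum one guarantees them for 0 < y < 1, and at all other heights
    the sets of f and g are empty. *)
Lemma prekopa_leindler_normalized (f g h : R -> R) :
  measurable_fun [set: R] f -> measurable_fun [set: R] g ->
  measurable_fun [set: R] h ->
  (forall x, 0 <= f x <= 1)%R -> (forall x, 0 <= g x <= 1)%R ->
  (forall x, 0 <= h x)%R ->
  (forall y, y < 1 -> exists x, y < f x)%R ->
  (forall y, y < 1 -> exists x, y < g x)%R ->
  (forall x y, Num.min (f x) (g y) <= h ((x + y) / 2))%R ->
  \int[mu]_x (f x)%:E + \int[mu]_x (g x)%:E <= 2%:E * \int[mu]_x (h x)%:E.
Proof.
move=> mf mg mh f01 g01 h0 supf supg fgh.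
have f0 x : (0 <= f x)%R by case/andP: (f01 x).
have g0 x : (0 <= g x)%R by case/andP: (g01 x).
have [-> mlf] := layer1 mf f0; have [-> mlg] := layer1 mg g0.
have [-> mlh] := layer1 mh h0.
rewrite -ge0_integralD// -ge0_integralZl//; apply: ge0_le_integral => //.
- by move=> y _; rewrite adde_ge0.
- exact: emeasurable_funD.
- exact: emeasurable_funM.
move=> y _; have [/andP[y0 y1]|y01] := boolP (0 < y < 1)%R; last first.
  have lev0 u : (forall x, u x <= 1)%R -> mu [set x | 0 < y < u x]%R = 0.
    move=> u1; rewrite [X in mu X](_ : _ = set0) ?measure0// -subset0 => x /=.
    move=> /andP[y0 yu]; move/negP: y01; apply.
    by rewrite y0 (lt_le_trans yu).
  have f1 x : (f x <= 1)%R by case/andP: (f01 x).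
  have g1 x : (g x <= 1)%R by case/andP: (g01 x).
  by rewrite (lev0 _ f1) (lev0 _ g1) adde0 mule_ge0.
have mlev (u : R -> R) : measurable_fun [set: R] u ->
    measurable [set x | 0 < y < u x]%R.
  move=> mu_.
  have := measurable_fun_ltr (@measurable_cst _ _ _ _ [set: R] y) mu_ measurableT.
  by move=> /(_ [set true] I); rewrite setTI y0.
apply: brunn_minkowski_itv; [exact: mlev..| | |].
- by have [x yx] := supf y y1; exists x; rewrite /= y0.
- by have [x yx] := supg y y1; exists x; rewrite /= y0.
- move=> a b /=; rewrite y0/= => ya yb.
  by apply: lt_le_trans (fgh a b); rewrite lt_min ya.
Qed.

(** Dividing f and g by their suprema a and b, and h by sqrt(a b), reaches the normalised case,
    because a minimum is at most a geometric mean. The bound on the sum returns to products by the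
    inequality of arithmetic and geometric means. *)
Lemma prekopa_leindler_bounded (f g h : R -> R) (M : R) :
  measurable_fun [set: R] f -> measurable_fun [set: R] g ->
  measurable_fun [set: R] h ->
  (forall x, 0 <= f x <= M)%R -> (forall x, 0 <= g x <= M)%R ->
  (forall x, 0 <= h x)%R ->
  (forall x y, f x * g y <= h ((x + y) / 2) ^+ 2)%R ->
  (\int[mu]_x (f x)%:E) * (\int[mu]_x (g x)%:E) <=
  (\int[mu]_x (h x)%:E) * (\int[mu]_x (h x)%:E).
Proof.
move=> mf mg mh f0M g0M h0 fgh.
have bnd (u : R -> R) : (forall x, 0 <= u x <= M)%R -> has_sup (range u).
  move=> u0M; split; first by exists (u 0%R), 0%R.
  by exists M => _ [x _ <-]; case/andP: (u0M x).
pose s (u : R -> R) := sup (range u).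
have ub (u : R -> R) (x : R) : (forall x, 0 <= u x <= M)%R -> (u x <= s u)%R.
  by move=> u0M; apply: ub_le_sup; [exact: (bnd _ u0M).2|exists x].
have scase (u : R -> R) : (forall x, 0 <= u x <= M)%R ->
    (0 < s u)%R \/ \int[mu]_x (u x)%:E = 0.
  move=> u0M; have [|su] := ltP 0%R (s u); [by left|right].
  apply: integral0_eq => x _; congr EFin; apply/eqP; rewrite eq_le.
  by case/andP: (u0M x) => -> _; rewrite (le_trans (ub _ _ u0M)).
have I0 (u : R -> R) : (forall x, 0 <= u x)%R -> 0 <= \int[mu]_x (u x)%:E.
  by move=> u0; apply: integral_ge0 => x _; rewrite lee_fin.
have f0 x : (0 <= f x)%R by case/andP: (f0M x).
have g0 x : (0 <= g x)%R by case/andP: (g0M x).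
have [a0|->] := scase f f0M; last by rewrite mul0e mule_ge0// I0.
have [b0|->] := scase g g0M; last by rewrite mule0 mule_ge0// I0.
set a := s f in a0; set b := s g in b0.
pose c := Num.sqrt (a * b)%R.
have c0 : (0 < c)%R by rewrite sqrtr_gt0 mulr_gt0.
have cE : (c ^+ 2 = a * b)%R by rewrite sqr_sqrtr// mulr_ge0// ltW.
have scal (u : R -> R) (k : R) : (0 < k)%R -> measurable_fun [set: R] u ->
    (forall x, 0 <= u x)%R ->
    \int[mu]_x (k^-1 * u x)%:E = k^-1%:E * \int[mu]_x (u x)%:E.
  move=> k0 mu_ u0; under eq_integral do rewrite EFinM.
  rewrite ge0_integralZl//; [exact/measurable_EFinP| |].
    by move=> x _; rewrite lee_fin.
  by rewrite lee_fin invr_ge0 ltW.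
have le1 (u : R -> R) : (forall x, 0 <= u x <= M)%R -> (0 < s u)%R ->
    forall x, (0 <= (s u)^-1 * u x <= 1)%R.
  move=> u0M su x; case/andP: (u0M x) => ux _.
  apply/andP; split; first by rewrite mulr_ge0// invr_ge0 ltW.
  by rewrite mulrC ler_pdivrMr// mul1r ub.
have sup1 (u : R -> R) : (forall x, 0 <= u x <= M)%R -> (0 < s u)%R ->
    forall y, (y < 1)%R -> exists x, (y < (s u)^-1 * u x)%R.
  move=> u0M su y y1.
  have /(sup_adherent (eps := s u * (1 - y))%R) : has_sup (range u) by exact: bnd.
  rewrite mulr_gt0// ?subr_gt0// => /(_ isT) [_ [x _ <-] H].
  exists x; rewrite mulrC ltr_pdivlMr//; move: H; rewrite -/(s u); lra.
have := @prekopa_leindler_normalized (fun x => a^-1 * f x)%R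
  (fun x => b^-1 * g x)%R (fun x => c^-1 * h x)%R.
rewrite !scal//; move=> /(_ _ _ _ (le1 _ f0M a0) (le1 _ g0M b0) _
  (sup1 _ f0M a0) (sup1 _ g0M b0)) H.
have {H} : a^-1%:E * (\int[mu]_x (f x)%:E) + b^-1%:E * (\int[mu]_x (g x)%:E) <=
    2%:E * (c^-1%:E * \int[mu]_x (h x)%:E).
  apply: H; [exact: measurable_funM..| |].
    by move=> x; rewrite mulr_ge0// invr_ge0 ltW.
  move=> x y; set m := Num.min _ _.
  have m0 : (0 <= m)%R by rewrite le_min !mulr_ge0// invr_ge0 ltW.
  have h0' : (0 <= c^-1 * h ((x + y) / 2))%R by rewrite mulr_ge0// invr_ge0 ltW.
  rewrite -(@ler_pXn2r _ 2)// ?nnegrE// exprMn exprVn cE.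
  apply: (@le_trans _ _ ((a^-1 * f x) * (b^-1 * g y))%R).
    by rewrite expr2 ler_pM// /m ge_min lexx ?orbT.
  by rewrite mulrACA -invfM ler_pM2l// invr_gt0 mulr_gt0.
(* An infinite integral of [h] leaves nothing to prove; with a finite one, [H] excludes infinite
   integrals of [f] and [g]. *)
have := I0 _ f0; have := I0 _ g0; have := I0 _ h0.
case: (\int[mu]_x (h x)%:E) => [Z|_ _ _ _|//]; last by rewrite mulyy leey.
have iM (k : R) : (0 < k)%R -> k^-1%:E * +oo = +oo :> \bar R.
  by move=> k0; rewrite gt0_muley// lte_fin invr_gt0.
case: (\int[mu]_x (f x)%:E) => [X|_ Y0|//]; last first.
  rewrite iM// addye ?leye_eq// gt_eqF// (lt_le_trans ltNy0)// mule_ge0//.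
  by rewrite lee_fin invr_ge0 ltW.
case: (\int[mu]_x (g x)%:E) => [Y|_ _|//]; last first.
  by rewrite iM//= addey// leye_eq.
rewrite -!EFinM -EFinD !lee_fin => Z0 Y0 X0 H.
have {H} : ((a^-1 * X) * (b^-1 * Y) <= (c^-1 * Z) ^+ 2)%R.
  have := sqr_ge0 (a^-1 * X - b^-1 * Y)%R.
  have : (0 <= a^-1 * X)%R by rewrite mulr_ge0// invr_ge0 ltW.
  have : (0 <= b^-1 * Y)%R by rewrite mulr_ge0// invr_ge0 ltW.
  move: H; move: (a^-1 * X)%R (b^-1 * Y)%R (c^-1 * Z)%R => x y z.
  nra.
by rewrite exprMn exprVn cE mulrACA -invfM ler_pM2l ?invr_gt0 ?mulr_gt0.
Qed.

(** Truncation at N preserves the hypothesis: if h exceeds N at the midpoint, both truncated factors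
    on the left are still at most N. Monotone convergence then removes the bound. *)
Theorem prekopa_leindler_lebesgue :
  @prekopa_leindler _ (measurableTypeR R) R (fun x y : R => (x + y) / 2)%R mu.
Proof.
move=> f g h mf mg mh f0 g0 h0 fgh.
pose t N (u : R -> \bar R) x := fine (mine (u x) N%:R%:E).
have tE N (u : R -> \bar R) x : (forall x, 0 <= u x) ->
    (t N u x)%:E = mine (u x) N%:R%:E.
  move=> u0; rewrite /t fineK// ge0_fin_numE; last by rewrite le_min u0 lee_fin ler0n.
  by rewrite gt_min ltry orbT.
have t0 N (u : R -> \bar R) x : (forall x, 0 <= u x) -> (0 <= t N u x)%R.
  by move=> u0; rewrite -lee_fin tE// le_min u0 lee_fin ler0n.
have tN N (u : R -> \bar R) x : (forall x, 0 <= u x) -> (t N u x <= N%:R)%R.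
  by move=> u0; rewrite -lee_fin tE// ge_min lexx orbT.
have mt N (u : R -> \bar R) : measurable_fun [set: R] u ->
    measurable_fun [set: R] (t N u).
  move=> mu_; apply: measurableT_comp => //.
  exact: measurable_mine.
have bounded N : \int[mu]_x (t N f x)%:E * \int[mu]_x (t N g x)%:E <=
    (\int[mu]_x h x) * (\int[mu]_x h x).
  apply: le_trans (_ : (\int[mu]_x (t N h x)%:E) * (\int[mu]_x (t N h x)%:E) <= _).
    apply: (@prekopa_leindler_bounded _ _ _ N%:R); [exact: mt..| | | |].
    - by move=> x; rewrite t0// tN.
    - by move=> x; rewrite t0// tN.
    - by move=> x; exact: t0.
    - move=> x y; rewrite -lee_fin expr2 !EFinM !tE//.
      have min0 (u : R -> \bar R) z : (forall x, 0 <= u x) ->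
          0 <= mine (u z) N%:R%:E.
        by move=> u0; rewrite le_min u0 lee_fin ler0n.
      have [hN|hN] := leP (h ((x + y) / 2)%R) N%:R%:E.
        apply: le_trans (fgh x y); apply: lee_pmul; [exact: min0..| |];
          by rewrite ge_min lexx.
      by apply: lee_pmul; [exact: min0..| |]; rewrite ge_min lexx orbT.
  have th : \int[mu]_x (t N h x)%:E <= \int[mu]_x h x.
    apply: ge0_le_integral => //.
    - by move=> x _; rewrite lee_fin t0.
    - by apply/measurable_EFinP; exact: mt.
    - by move=> x _; rewrite tE// ge_min lexx.
  by apply: lee_pmul => //; apply: integral_ge0 => x _; rewrite lee_fin t0.
have I0 (u : R -> \bar R) : (forall x, 0 <= u x) -> 0 <= \int[mu]_x u x.
  by move=> u0; exact: integral_ge0.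
have cvg_t (u : R -> \bar R) : measurable_fun [set: R] u -> (forall x, 0 <= u x) ->
    \int[mu]_x (t N u x)%:E @[N --> \oo] --> \int[mu]_x u x.
  move=> mu_ u0.
  rewrite [X in _ --> X](_ : _ =
      \int[mu]_x (fun x0 => limn (fun N => (t N u x0)%:E)) x); last first.
    apply: eq_integral => x _; apply/esym/cvg_lim => //.
    under eq_fun do rewrite tE//.
    have := u0 x; case: (u x) => [r| |//] _.
      apply: (@cvg_near_cst _ _ _ _ _).
      near=> N; apply/min_idPl; rewrite lee_fin ltW//.
      by near: N; exact: nbhs_infty_gtr.
    rewrite (_ : (fun=> _) = (fun N => N%:R%:E)).
      by apply/cvgeryP; exact: cvgr_idn.
    by apply/funext => N; rewrite /mine ltNge leey.
  apply: cvg_monotone_convergence => //.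
  - by move=> N; apply/measurable_EFinP; exact: mt.
  - by move=> N x _; rewrite lee_fin t0.
  - move=> x _ m n mn; rewrite !tE// le_min !ge_min lexx/=.
    by rewrite lee_fin ler_nat mn orbT.
(* Vanishing integrals are settled first, so that the product of the two limits is not of the form
   zero times infinity. *)
have [->|If0] := eqVneq (\int[mu]_x f x) 0; first by rewrite mul0e mule_ge0// I0.
have [->|Ig0] := eqVneq (\int[mu]_x g x) 0; first by rewrite mule0 mule_ge0// I0.
have cv : \int[mu]_x (t N f x)%:E * \int[mu]_x (t N g x)%:E @[N --> \oo] -->
    (\int[mu]_x f x) * (\int[mu]_x g x).
  apply: cvgeM; [|exact: cvg_t|exact: cvg_t].
  by rewrite mule_defE (negbTE If0) (negbTE Ig0).
rewrite -(cvg_lim _ cv)//; apply: lime_le; last exact: nearW.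
by apply/cvg_ex; eexists; exact: cv.
Unshelve. all: by end_near. Qed.

End prekopa_leindler.

(** * Prékopa-Leindler in R^n, volume of convex bodies *)

Section prekopa_leindler_rV.
Local Open Scope ereal_scope.
Context {R : realType}.

(** For fixed first coordinates the sections satisfy the hypothesis on the second factor, and the
    conclusion there is the hypothesis on the first factor for the partial integrals. These may be
    infinite, hence the extended real functions in the definition. *)
Lemma prekopa_leindler_prod d1 d2 (T1 : measurableType d1)
    (T2 : measurableType d2) (mid1 : T1 -> T1 -> T1) (mid2 : T2 -> T2 -> T2)
    (mu1 : {sigma_finite_measure set T1 -> \bar R})
    (mu2 : {sigma_finite_measure set T2 -> \bar R}) :
  prekopa_leindler mid1 mu1 -> prekopa_leindler mid2 mu2 ->
  prekopa_leindler (fun p q => (mid1 p.1 q.1, mid2 p.2 q.2)) (mu1 \x mu2).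
Proof.
move=> pl1 pl2 f g h mf mg mh f0 g0 h0 fgh.
rewrite !fubini_tonelli1//; apply: pl1;
  [exact: measurable_fun_fubini_tonelli_F..| | | |];
  [by move=> x; exact: integral_ge0..|].
by move=> x y; rewrite /fubini_F; apply: pl2 => //;
  apply: measurableT_comp => //; exact: pair1_measurable.
Qed.

(** Meant for [rV_cons], which carries the product measure to [lebesgue_rV] and commutes with
    midpoints. *)
Lemma prekopa_leindler_pushforward d1 d2 (T1 : measurableType d1)
    (T2 : measurableType d2) (mid1 : T1 -> T1 -> T1) (mid2 : T2 -> T2 -> T2)
    (phi : T1 -> T2) (mphi : measurable_fun setT phi)
    (mu : {measure set T1 -> \bar R}) (nu : {measure set T2 -> \bar R}) :
  (forall A, measurable A -> nu A = mu (phi @^-1` A)) ->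
  (forall x y, phi (mid1 x y) = mid2 (phi x) (phi y)) ->
  prekopa_leindler mid1 mu -> prekopa_leindler mid2 nu.
Proof.
move=> nuE phiE pl f g h mf mg mh f0 g0 h0 fgh.
have int (u : T2 -> \bar R) : measurable_fun setT u -> (forall x, 0 <= u x) ->
    \int[nu]_x u x = \int[mu]_x u (phi x).
  move=> mu_ u0.
  rewrite -[RHS](@ge0_integral_pushforward _ _ _ _ _ _ mphi mu setT)//.
  by apply: eq_measure_integral => A mA _; exact: nuE.
rewrite !int//; apply: pl => //.
- exact: measurableT_comp.
- exact: measurableT_comp.
- exact: measurableT_comp.
- by move=> x y /=; rewrite phiE.
Qed.

Lemma prekopa_leindler_rV n :
  prekopa_leindler (fun x y : 'rV[R]_n => 2^-1 *: (x + y))%R (lebesgue_rV n).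
Proof.
elim: n => [|n ih].
  move=> f g h mf mg mh f0 g0 h0 fgh.
  rewrite !integral_dirac// diracE mem_set// !mul1e.
  by rewrite (le_trans (fgh _ _))// addr0 scaler0.
have := prekopa_leindler_prod (@prekopa_leindler_lebesgue R) ih.
apply: prekopa_leindler_pushforward => //; first exact: measurable_rV_cons.
move=> [a x] [b y]; apply/rowP => i; rewrite !mxE /=.
case: unliftP => [j|] _ /=; rewrite ?mxE//.
by rewrite mulrC.
Qed.

End prekopa_leindler_rV.

Section measurable_sets_rV.
Local Open Scope ereal_scope.
Context {R : realType}.

Lemma ball_rVE n (c x : 'rV[R]_n) (r : R) : (0 < r)%R ->
  ball c r x <-> forall i, ball (c ord0 i) r (x ord0 i).
Proof.
move=> r0; split=> [[_ cx] i|cx]; first exact: cx.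
by split => // i j; rewrite !ord1.
Qed.

Lemma measurable_ball_rV n (c : 'rV[R]_n) (r : R) : (0 < r)%R ->
  measurable (ball c r).
Proof.
move=> r0; rewrite (_ : ball c r = \bigcap_(i in [set: 'I_n])
    [set x : 'rV[R]_n | ball (c ord0 i) r (x ord0 i)]).
  apply: fin_bigcap_measurable => // i _.
  rewrite -[X in measurable X]setTI.
  by apply: (measurable_rV_coord i); [exact: measurableT|exact: measurable_ball].
apply/seteqP; split => x.
  by move=> /(ball_rVE _ _ r0) cx i _; exact: cx.
by move=> cx; apply/(ball_rVE _ _ r0) => i; exact: cx.
Qed.

(** Sup-norm balls are boxes, hence in the product sigma-algebra, and those with rational centre and
    radius 1/(k+1) form a countable base. *)
Lemma open_measurable_rV n (U : set 'rV[R]_n) : open U -> measurable U.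
Proof.
move=> oU.
pose B (qk : 'rV[rat]_n * nat) : set 'rV[R]_n :=
  ball (map_mx (@ratr R) qk.1 : 'rV[R]_n) qk.2.+1%:R^-1.
pose F qk := if `[< B qk `<=` U >] then B qk else set0.
rewrite (_ : U = \bigcup_qk F qk).
  apply: countable_bigcupT_measurable; first exact: countableP.
  move=> qk; rewrite /F; case: ifPn => // _.
  by apply: measurable_ball_rV; rewrite invr_gt0.
apply/seteqP; split => [x Ux|x [qk _]]; last first.
  by rewrite /F; case: ifPn => [/asboolP BU /BU|].
have [e /= e0 xeU] : exists2 e : R, (0 < e)%R & ball x e `<=` U.
  by have /nbhs_ballP[e ? ?] : nbhs x U by [exact: open_nbhs_nbhs]; exists e.
(* The radius is taken below [e / 2], so that a ball of this radius containing [x] stays in the ball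
   of radius [e] around [x]. *)
have [k _ /(_ k (leqnn k)) /= ke] := near_infty_natSinv_lt (PosNum (divr_gt0 e0 (ltr0Sn R 1))).
have k0 : (0 < k.+1%:R^-1 :> R)%R by rewrite invr_gt0.
have /choice[q qx] : forall i : 'I_n, exists q : rat, ball (ratr q : R) (k.+1%:R^-1) (x ord0 i).
  move=> i; have [q] : exists q : rat, ratr q \in
      `](x ord0 i - k.+1%:R^-1)%R, (x ord0 i + k.+1%:R^-1)%R[.
    by apply: rat_in_itvoo; rewrite ltrD2l (lt_trans _ k0)// oppr_lt0.
  rewrite in_itv/= => qx; exists q; rewrite /ball/= distrC ltr_distlC.
  by move: qx; rewrite !(ltrBlDr, ltrBrDr).
have Bx : B (\row_i q i, k) x.
  by apply/(ball_rVE _ _ k0) => i; rewrite !mxE.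
exists (\row_i q i, k) => //; rewrite /F; case: asboolP => // nBU.
exfalso; apply: nBU => y By; apply: xeU.
rewrite (splitr e); apply: ball_triangle (le_ball (ltW ke) (ball_sym Bx)) _.
exact: (le_ball (ltW ke)).
Qed.

Lemma compact_measurable_rV n (K : set 'rV[R]_n) : compact K -> measurable K.
Proof.
move=> cK; rewrite -(setCK K); apply: measurableC.
by apply: open_measurable_rV; rewrite openC; exact: compact_closed.
Qed.

(** Balls are cubes of side 2r. A convex body lies in one and contains another, which makes its
    volume finite and positive. *)
Lemma lebesgue_rV_ball n (c : 'rV[R]_n) (r : R) : (0 < r)%R ->
  lebesgue_rV n (ball c r) = ((r *+ 2) ^+ n)%:E.
Proof.
move=> r0; elim: n => [|n ih] in c *.
  rewrite expr0 /= diracE mem_set//.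
  by apply/(ball_rVE _ _ r0) => -[].
rewrite /= /lebesgue_rV_step /pushforward.
rewrite (_ : _ @^-1` _ = ball (c ord0 ord0) r `*` ball (rV_uncons c).2 r).
  rewrite product_measure1E; [|exact: measurable_ball|exact: measurable_ball_rV].
  rewrite exprS EFinM; congr (_ * _); last exact: ih.
  exact: (lebesgue_measure_ball _ (ltW r0)).
apply/seteqP; split => -[a x].
  move=> /(ball_rVE _ _ r0) cx; split.
    by have := cx ord0; rewrite mxE unlift_none.
  by apply/(ball_rVE _ _ r0) => i; have := cx (lift ord0 i); rewrite !mxE liftK.
move=> [/= ca /(ball_rVE _ _ r0) cx]; apply/(ball_rVE _ _ r0) => i.
rewrite mxE; case: unliftP => [j ->|-> //=].
by have := cx j; rewrite mxE.
Qed.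

Lemma convex_body_measurable n (K : set 'rV[R]_n) : convex_body K -> measurable K.
Proof. by case=> cK _ _; exact: compact_measurable_rV. Qed.

Lemma convex_body_fin n (K : set 'rV[R]_n) :
  convex_body K -> lebesgue_rV n K < +oo.
Proof.
move=> Kb; have [/compact_bounded [M [_ KM]] _ _] := Kb.
have M0 : (0 < `|M| + 1)%R by rewrite ltr_wpDl.
have M1 : (0 < `|M| + 1 + 1)%R by rewrite ltr_wpDl// ltW.
apply: (@le_lt_trans _ _ (lebesgue_rV n (ball 0%R (`|M| + 1 + 1)%R))).
  apply: measure_mono.
  - exact: convex_body_measurable.
  - exact: measurable_ball_rV.
  - move=> x Kx; rewrite mx_norm_ball /ball_/= sub0r normrN.
    apply: (le_lt_trans (KM (`|M| + 1)%R _ x Kx)); last by rewrite ltrDl.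
    by rewrite (le_lt_trans (ler_norm M))// ltrDl.
by rewrite lebesgue_rV_ball// ltry.
Qed.

Lemma convex_body_vol n (K : set 'rV[R]_n) : convex_body K ->
  lebesgue_rV n K = (vol K)%:E /\ (0 < vol K)%R.
Proof.
move=> Kb; have volE : lebesgue_rV n K = (vol K)%:E.
  by rewrite /vol fineK// ge0_fin_numE// convex_body_fin.
split => //; rewrite -lte_fin -volE; have [_ _ [c]] := Kb.
move=> /nbhs_ballP[e /= e0 ceK].
apply: lt_le_trans (_ : lebesgue_rV n (ball c e) <= _).
  by rewrite lebesgue_rV_ball// lte_fin exprn_gt0// pmulrn_lgt0.
apply: measure_mono => //; [exact: measurable_ball_rV|].
exact: convex_body_measurable.
Qed.

End measurable_sets_rV.

(** * Laplace transforms of cosines and the Poisson kernel *)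

Section improper_integrals.
Context {R : realType}.
Local Notation mu := (@lebesgue_measure R).

Lemma is_derive_continuous (F : R -> R) (x df : R) :
  is_derive x 1 F df -> {for x, continuous F}.
Proof. by move=> [dF _]; apply/differentiable_continuous/derivable1_diffP. Qed.

Lemma integral_FTC2y (F f : R -> R) (a l : R) :
  (forall x, a <= x -> 0 <= f x) ->
  (forall x, a <= x -> {for x, continuous f}) ->
  (forall x, a <= x -> is_derive x 1 F (f x)) ->
  F x @[x --> +oo] --> l ->
  (\int[mu]_(x in `]a, +oo[) (f x)%:E = (l - F a)%:E)%E.
Proof.
move=> f0 cf dF Fl.
have wcf : {within `[a, +oo[, continuous f}.
  apply/continuous_within_itvcyP; split.
    by move=> x; rewrite in_itv/= andbT => /ltW; exact: cf.
  by apply: cvg_at_right_filter; exact: cf.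
rewrite integral_itv_obnd_cbnd; last first.
  apply/measurable_EFinP; apply: open_continuous_measurable_fun => //.
  by move=> x; rewrite inE/= in_itv/= andbT => /ltW; exact: cf.
rewrite (@ge0_continuous_FTC2y _ f F a l)//.
- by move=> x /ltW /dF [].
- by apply: cvg_at_right_filter; apply: is_derive_continuous (dF a (lexx a)).
- move=> x; rewrite in_itv/= andbT => /ltW /dF [_ <-].
  by rewrite derive1E.
Qed.

Lemma is_derive_mull (k r : R) : is_derive r 1 ( *%R k) k.
Proof.
have := @is_deriveZ _ _ _ id k r 1 1 (is_derive_id _ _).
by rewrite /GRing.scale/= mulr1.
Qed.

Lemma is_derive_comp_mull (f : R -> R) (k r df : R) :
  is_derive (k * r) 1 f df -> is_derive r 1 (fun x => f (k * x)) (df * k).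
Proof.
move=> fdf; exact: (@is_derive1_comp _ f ( *%R k) r df k fdf (is_derive_mull k r)).
Qed.

Lemma cvgy_expRM (s : R) : 0 < s -> expR (- s * r) @[r --> +oo] --> 0.
Proof.
move=> s0; rewrite (_ : (fun r => _) = (fun z => expR (- z)) \o ( *%R s)).
  apply: (@cvg_comp _ _ _ _ _ _ (pinfty_nbhs R)); last exact: cvgr_expR.
  exact: gt0_cvgMry.
by apply/funext => x; rewrite /= mulNr.
Qed.

Lemma laplace_cos (s z : R) : 0 < s ->
  (\int[mu]_(r in `]0%R, +oo[) (expR (- s * r) * (1 + cos (z * r)))%:E)%E =
  (s^-1 + s / (s ^+ 2 + z ^+ 2))%:E.
Proof.
move=> s0.
have D0 : s ^+ 2 + z ^+ 2 != 0 by rewrite gt_eqF// ltr_wpDr// ?sqr_ge0// exprn_gt0.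
pose E (r : R) := expR (- s * r).
(* Chosen so that [E r * B r] is an antiderivative: the first term accounts for exp(-s r) cos(z r),
   the term -1/s for exp(-s r). *)
pose B (r : R) :=
  (s ^+ 2 + z ^+ 2)^-1 * (z * sin (z * r) - s * cos (z * r)) - s^-1.
have dE (r : R) : is_derive r 1 E (E r * - s).
  by apply: is_derive_comp_mull; exact: is_derive_expR.
have dc (r : R) : is_derive r 1 (fun r => cos (z * r)) (- sin (z * r) * z).
  by apply: is_derive_comp_mull; exact: is_derive_cos.
have ds (r : R) : is_derive r 1 (fun r => sin (z * r)) (cos (z * r) * z).
  by apply: is_derive_comp_mull; exact: is_derive_sin.
have dB (r : R) : is_derive r 1 B ((s ^+ 2 + z ^+ 2)^-1 *
    (z * (cos (z * r) * z) - s * (- sin (z * r) * z))).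
  have h1 := is_deriveB (is_deriveZ z (ds r)) (is_deriveZ s (dc r)).
  have h2 := is_deriveB (is_deriveZ (s ^+ 2 + z ^+ 2)^-1 h1)
    (is_derive_cst s^-1 r 1).
  by apply: (is_derive_eq h2); rewrite subr0.
have dF (r : R) : is_derive r 1 (fun r => E r * B r)
    (expR (- s * r) * (1 + cos (z * r))).
  apply: (is_derive_eq (is_deriveM (dE r) (dB r))).
  rewrite /GRing.scale/= /B /E; field.
  by rewrite D0 gt_eqF.
rewrite (@integral_FTC2y (fun r => E r * B r) _ 0 0) //.
- rewrite /E /B mulr0 expR0 mul1r mulr0 sin0 cos0; congr EFin; field.
  by rewrite D0 gt_eqF.
- move=> x _; apply: continuousM.
    exact: is_derive_continuous (dE x).
  by apply: continuousD; [exact: cst_continuous|exact: is_derive_continuous (dc x)].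
- pose C := `|(s ^+ 2 + z ^+ 2)^-1| * (`|z| + `|s|) + `|s^-1|.
  have BC r : `|B r| <= C.
    rewrite (le_trans (ler_normB _ _))// lerD2r normrM ler_wpM2l//.
    rewrite (le_trans (ler_normB _ _))// lerD// normrM ler_piMr//.
      by rewrite ler_norml sin_geN1 sin_le1.
    by rewrite ler_norml cos_geN1 cos_le1.
  apply/norm_cvg0P; apply: (@squeeze_cvgr _ _ _ _ (cst 0) (fun r => C * E r)).
  + apply: nearW => r; rewrite normr_ge0/= normrM mulrC.
    by rewrite (ger0_norm (expR_ge0 _)) ler_wpM2r// expR_ge0.
  + exact: cvg_cst.
  + by rewrite -(mulr0 C); apply: cvgMr; exact: cvgy_expRM.
Qed.
End improper_integrals.

Section poisson_kernel.
Context {R : realType}.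
Local Notation mu := (@lebesgue_measure R).
Local Notation RT := (measurableTypeR R).

(** Up to the factor pi, the Poisson kernel of the half-plane; here it arises as the Laplace
    transform at s of r -> cos(z r). *)
Definition poisson (s z : R) : R := s / (s ^+ 2 + z ^+ 2).

Lemma poisson_ge0 s z : 0 < s -> 0 <= poisson s z.
Proof. by move=> s0; rewrite divr_ge0 ?addr_ge0 ?sqr_ge0// ltW. Qed.

Lemma poisson_denom_gt0 (s z : R) : 0 < s -> 0 < s ^+ 2 + z ^+ 2.
Proof. by move=> s0; rewrite ltr_wpDr ?sqr_ge0// exprn_gt0. Qed.

Lemma continuous_poisson s : 0 < s -> continuous (poisson s).
Proof.
move=> s0 z.
suff : {for z, continuous (fun z : R => s / (s ^+ 2 + z ^+ 2))} by [].
apply: (@continuousM _ _ (cst s) (fun z : R => (s ^+ 2 + z ^+ 2)^-1)).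
  exact: cst_continuous.
apply: (@continuousV _ _ (fun z : R => s ^+ 2 + z ^+ 2)).
  by rewrite gt_eqF// poisson_denom_gt0.
apply: (@continuousD _ _ _ (cst (s ^+ 2)) (fun z : R => z ^+ 2)).
  exact: cst_continuous.
exact: exprn_continuous.
Qed.

Lemma measurable_poisson s : 0 < s -> measurable_fun [set: R] (poisson s).
Proof. by move=> s0; apply: continuous_measurable_fun; exact: continuous_poisson. Qed.

Lemma poisson_level (s y : R) : 0 < s ->
  (exists2 t, 0 < t & [set z | 0 < y < poisson s z] = `]- t, t[%classic) \/
  [set z | 0 < y < poisson s z] = set0.
Proof.
move=> s0; have [y0|y0] := leP y 0.
  by right; rewrite -subset0 => z.
have kE z : (y < poisson s z) = (z ^+ 2 < s / y - s ^+ 2).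
  rewrite /poisson ltr_pdivlMr ?poisson_denom_gt0// ltrBrDl ltr_pdivlMr//.
  by rewrite mulrC.
have [t0|t0] := leP (s / y - s ^+ 2) 0.
  right; rewrite -subset0 => z /andP[_]; rewrite kE => /lt_le_trans /(_ t0).
  by rewrite ltNge sqr_ge0.
left; exists (Num.sqrt (s / y - s ^+ 2)); first by rewrite sqrtr_gt0.
apply/seteqP; split => z; rewrite /= in_itv/= kE -ltr_norml.
  by move=> zt; rewrite -sqrtr_sqr ltr_sqrt.
by rewrite -sqrtr_sqr ltr_sqrt.
Qed.

Local Open Scope ereal_scope.

(** By the layer cake formula the kernel is a mixture of the indicators of its superlevel sets, and
    by [poisson_level] these are symmetric intervals or empty. *)
Lemma poisson_integral_mono (m1 m2 : {sigma_finite_measure set RT -> \bar R})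
    (w1 w2 : RT -> \bar R) (s : R) : (0 < s)%R ->
  measurable_fun setT w1 -> measurable_fun setT w2 ->
  (forall x, 0 <= w1 x) -> (forall x, 0 <= w2 x) ->
  (forall t, (0 < t)%R -> \int[m1]_x ((\1_`]- t, t[ x)%:E * w1 x) <=
    \int[m2]_x ((\1_`]- t, t[ x)%:E * w2 x)) ->
  \int[m1]_x ((poisson s x)%:E * w1 x) <= \int[m2]_x ((poisson s x)%:E * w2 x).
Proof.
move=> s0 mw1 mw2 w10 w20 H.
have mk := measurable_poisson s0.
have k0 z := poisson_ge0 z s0.
rewrite !layer_cake//; apply: ge0_le_integral => //.
- move=> y _; apply: integral_ge0 => x _.
  by apply: mule_ge0 => //; rewrite lee_fin.
- exact: measurable_layer.
- exact: measurable_layer.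
- move=> y _; have [[t t0 ->]| ->] := poisson_level y s0; first exact: H.
  under eq_integral do rewrite indicE in_set0 mul0e.
  rewrite integral0; apply: integral_ge0 => x _.
  by apply: mule_ge0 => //; rewrite lee_fin.
Qed.

End poisson_kernel.

Section tonelli_in.
Local Open Scope ereal_scope.
Context {R : realType}.

Lemma integral_in_indic d (T : measurableType d) (mu : {measure set T -> \bar R})
    (D : set T) (f : T -> \bar R) :
  \int[mu]_(x in D) f x = \int[mu]_x ((\1_D x)%:E * f x).
Proof.
rewrite integral_mkcond; apply: eq_integral => x _.
by rewrite epatch_indic muleC.
Qed.

Lemma tonelli_in d1 d2 (T1 : measurableType d1) (T2 : measurableType d2)
    (m1 : {sigma_finite_measure set T1 -> \bar R})
    (m2 : {sigma_finite_measure set T2 -> \bar R}) (D : set T1) (E : set T2)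
    (f : T1 -> T2 -> \bar R) :
  measurable D -> measurable E ->
  measurable_fun [set: T1 * T2] (fun p => f p.1 p.2) ->
  (forall x y, 0 <= f x y) ->
  \int[m1]_(x in D) \int[m2]_(y in E) f x y =
  \int[m2]_(y in E) \int[m1]_(x in D) f x y.
Proof.
move=> mD mE mf f0.
have mfx x : measurable_fun [set: T2] (f x).
  exact: (measurableT_comp mf (pair1_measurable x)).
have mfy y : measurable_fun [set: T1] (fun x => f x y).
  exact: (measurableT_comp mf (pair2_measurable y)).
have mi d (T : measurableType d) (A : set T) : measurable A ->
    measurable_fun setT (fun x => (\1_A x)%:E : \bar R).
  by move=> mA; apply/measurable_EFinP; exact: measurable_indic.
have i0 T (A : set T) x : 0 <= (\1_A x)%:E :> \bar R by rewrite lee_fin.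
transitivity (\int[m1]_x \int[m2]_y ((\1_D x)%:E * ((\1_E y)%:E * f x y))).
  rewrite integral_in_indic; apply: eq_integral => x _.
  rewrite integral_in_indic ge0_integralZl//.
    by apply: emeasurable_funM => //; exact: mi.
  by move=> y _; exact: mule_ge0.
rewrite (fubini_tonelli (fun p : T1 * T2 =>
  (\1_D p.1)%:E * ((\1_E p.2)%:E * f p.1 p.2)))//=; last 2 first.
- apply: emeasurable_funM; first exact: (measurableT_comp (mi _ _ _ mD)).
  by apply: emeasurable_funM => //; exact: (measurableT_comp (mi _ _ _ mE)).
- by move=> p; rewrite !mule_ge0.
rewrite [RHS]integral_in_indic; apply: eq_integral => y _.
rewrite (integral_in_indic _ D) -ge0_integralZl//.
- by apply: eq_integral => x _; rewrite muleCA.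
- by apply: emeasurable_funM => //; exact: mi.
- by move=> x _; exact: mule_ge0.
Qed.

End tonelli_in.

(** * Cosine transform of a finite measure on the line *)

Section spectral.
Local Open Scope ereal_scope.
Context {R : realType}.
Local Notation RT := (measurableTypeR R).
Local Notation mu := (@lebesgue_measure R).

(** Cancels the contribution of the 1 in 1 + cos; the remaining terms may be infinite. *)
Lemma adde_EFin_inj (x : R) (a b : \bar R) : x%:E + a = x%:E + b -> a = b.
Proof.
move=> ab; apply/eqP; rewrite eq_le.
by rewrite -(@leeD2lE _ x%:E a b)// -(@leeD2lE _ x%:E b a)// ab lexx.
Qed.

Lemma measurable_expRM (s : R) :
  measurable_fun [set: R] (fun r : R => (expR (s * r))%:E).
Proof.
by apply/measurable_EFinP; apply: measurableT_comp => //.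
Qed.

Lemma laplace_one (s : R) : (0 < s)%R ->
  \int[mu]_(r in `]0%R, +oo[) (expR (- s * r))%:E = s^-1%:E.
Proof.
move=> s0; have := laplace_cos 0 s0.
under eq_integral do rewrite mul0r cos0 mulrC EFinM.
rewrite ge0_integralZl//; last by apply: measurable_funTS; exact: measurable_expRM.
rewrite expr0n addr0 => H.
have -> : s^-1%:E = (2^-1)%:E * (s^-1 + s / s ^+ 2)%:E :> \bar R.
  by rewrite -EFinM; congr EFin; field; exact: lt0r_neq0.
by rewrite -H muleA -EFinM (_ : (2^-1 * (1 + 1) = 1)%R) ?mul1e//; field.
Qed.

Lemma measurable_damped_cos d (T : measurableType d) (s : R) (f g : T -> R) :
  measurable_fun setT f -> measurable_fun setT g ->
  measurable_fun setT (fun x => (expR (- s * f x) * (1 + cos (g x * f x)))%:E).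
Proof.
move=> mf mg; apply/measurable_EFinP; apply: measurable_funM.
  by apply: measurableT_comp => //; exact: measurable_funM.
apply: measurable_funD => //.
apply: measurableT_comp; first exact: (continuous_measurable_fun (@continuous_cos R)).
exact: measurable_funM.
Qed.

Variables (lam : {finite_measure set RT -> \bar R}) (m : R) (phi : R -> R).
Hypotheses (m_gt0 : (0 < m)%R) (lamT : lam setT = m%:E).
Hypothesis phi_ge0 : (forall r, 0 <= phi r)%R.
(** Since [lam] has mass [m], this makes [phi] the cosine transform of [lam], in a form with
    non-negative integrand. *)
Hypothesis phiE : forall r, \int[lam]_z (1 + cos (z * r))%:E = (m + phi r)%:E.

Let cos1_ge0 (t : R) : (0 <= 1 + cos t)%R.
Proof. by rewrite -lerBlDl sub0r cos_geN1. Qed.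

Let mcos1 (r : R) : measurable_fun [set: RT] (fun z : RT => (1 + cos (z * r))%:E).
Proof.
apply/measurable_EFinP; apply: measurable_funD => //.
apply: measurableT_comp; first exact: (continuous_measurable_fun (@continuous_cos R)).
exact: measurable_funM.
Qed.

Lemma spectral_le r : (phi r <= m)%R.
Proof.
rewrite -(lerD2l m) -lee_fin -phiE.
apply: (@le_trans _ _ (\int[lam]_z (cst (2%:E)) z)).
  apply: ge0_le_integral => // z _; rewrite lee_fin.
  by rewrite lerD2l cos_le1.
by rewrite integral_cst// [X in _ * X]lamT -EFinM lee_fin; lra.
Qed.

Lemma measurable_spectral : measurable_fun [set: RT] phi.
Proof.
rewrite (_ : phi = fun r => fine (\int[lam]_z (1 + cos (z * r))%:E) - m)%R; last first.
  by apply/funext => r; rewrite phiE /= addrC addKr.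
apply: measurable_funB => //; apply: measurableT_comp => //.
(* The exponential with rate 0 is the constant 1, inserted to reach the form of
   [measurable_damped_cos]. *)
pose f (p : RT * RT) : \bar R := (expR (- 0 * p.1) * (1 + cos (p.2 * p.1)))%:E.
rewrite (_ : (fun r => _) = fubini_F lam f); last first.
  apply/funext => r; apply: eq_integral => z _.
  by rewrite /f/= oppr0 mul0r expR0 mul1r.
apply: measurable_fun_fubini_tonelli_F;
  first exact: (measurable_damped_cos 0 measurable_fst measurable_snd).
by move=> p; rewrite lee_fin mulr_ge0 ?expR_ge0.
Qed.

(** The double integral of exp(-s r) (1 + cos(z r)) is computed in both orders; the 1 contributes m
    / s each time. *)
Lemma spectral_laplace (s : R) : (0 < s)%R ->
  \int[mu]_(r in `]0%R, +oo[) (phi r * expR (- s * r))%:E =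
  \int[lam]_z (poisson s z)%:E.
Proof.
move=> s0.
have mexp : measurable_fun (`]0%R, +oo[%classic : set RT) (fun r : RT => (expR (- s * r))%:E).
  by apply: measurable_funTS; exact: measurable_expRM.
have mpois : measurable_fun [set: RT] (fun z : RT => (poisson s z)%:E).
  by apply/measurable_EFinP; exact: measurable_poisson.
have inner r : \int[lam]_z (expR (- s * r) * (1 + cos (z * r)))%:E =
    m%:E * (expR (- s * r))%:E + (phi r * expR (- s * r))%:E.
  under eq_integral do rewrite EFinM.
  rewrite ge0_integralZl//.
  by rewrite phiE -!EFinM -EFinD; congr EFin; ring.
have : \int[mu]_(r in `]0%R, +oo[) \int[lam]_z
      (expR (- s * r) * (1 + cos (z * r)))%:E =
    \int[lam]_z \int[mu]_(r in `]0%R, +oo[)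
      (expR (- s * r) * (1 + cos (z * r)))%:E.
  apply: (@tonelli_in _ _ _ RT RT mu lam _ setT (fun r z =>
    (expR (- s * r) * (1 + cos (z * r)))%:E)) => //.
  exact: (measurable_damped_cos s measurable_fst measurable_snd).
under eq_integral do rewrite inner.
rewrite ge0_integralD//=; last 4 first.
- by move=> r _; rewrite -EFinM lee_fin mulr_ge0 ?expR_ge0// ltW.
- exact: emeasurable_funM.
- by move=> r _; rewrite lee_fin mulr_ge0 ?expR_ge0.
- apply/measurable_EFinP/measurable_funTS; apply: measurable_funM.
    exact: measurable_spectral.
  by apply/measurable_EFinP; exact: measurable_expRM.
under [RHS]eq_integral do rewrite laplace_cos//.
rewrite ge0_integralZl//; last by rewrite lee_fin ltW.
rewrite laplace_one//.
have poissonE z : (s^-1 + s / (s ^+ 2 + z ^+ 2))%:E = s^-1%:E + (poisson s z)%:E.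
  by [].
under [RHS]eq_integral do rewrite poissonE.
rewrite ge0_integralD//=; last 2 first.
- by move=> r _; rewrite lee_fin invr_ge0 ltW.
- by move=> r _; rewrite lee_fin poisson_ge0.
have -> : \int[lam]_z s^-1%:E = m%:E * s^-1%:E.
  by rewrite integral_cst// [X in _ * X]lamT muleC.
rewrite -EFinM; exact: adde_EFin_inj.
Qed.

End spectral.

Section total_mass_bound.
Local Open Scope ereal_scope.
Context {R : realType}.
Local Notation RT := (measurableTypeR R).
Local Notation mu := (@lebesgue_measure R).

(** The antiderivative is atan(z / s). The value does not depend on [s], so a bound on Laplace
    transforms obtained from it survives the limit s -> 0. *)
Lemma integral_poisson (s : R) : (0 < s)%R ->
  \int[mu]_(z in `]0%R, +oo[) (poisson s z)%:E = (pi / 2)%:E.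
Proof.
move=> s0.
have dF (z : R) : is_derive z (1 : R)%R (fun z => atan (s^-1 * z))%R (poisson s z).
  apply: (is_derive_eq (is_derive_comp_mull (is_derive1_atan (s^-1 * z)%R))).
  rewrite /poisson; field.
  by rewrite gt_eqF ?poisson_denom_gt0//= gt_eqF.
rewrite (@integral_FTC2y R (fun z => atan (s^-1 * z))%R (poisson s) 0%R (pi / 2)%R).
- by rewrite mulr0 atan0 subr0.
- by move=> z _; exact: poisson_ge0.
- by move=> z _; exact: continuous_poisson.
- apply: (@cvg_comp _ _ _ (fun z => s^-1 * z)%R atan _ (pinfty_nbhs R)).
    by apply: gt0_cvgMry => //; rewrite invr_gt0.
  exact: cvgy_atan.
Qed.

(** Along the rates s = 1/(n+1) the damped integrands increase to phi, and monotone convergence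
    applies. *)
Lemma integral_damped_le (phi : R -> R) (B : \bar R) :
  measurable_fun [set: R] phi -> (forall r, 0 <= phi r)%R ->
  (forall s, (0 < s)%R ->
    \int[mu]_(r in `]0%R, +oo[) (phi r * expR (- s * r))%:E <= B) ->
  \int[mu]_(r in `]0%R, +oo[) (phi r)%:E <= B.
Proof.
move=> mphi phi0 H.
pose g n (r : RT) : \bar R := (phi r * expR (- n.+1%:R^-1 * r))%:E.
have mD : measurable (`]0%R, +oo[%classic : set RT) by exact: measurable_itv.
have mg n : measurable_fun (`]0%R, +oo[%classic : set RT) (g n).
  apply/measurable_EFinP/measurable_funTS/measurable_funM => //.
  by apply/measurable_EFinP; exact: measurable_expRM.
have g0 n (x : RT) : `]0%R, +oo[%classic x -> 0 <= g n x.
  by move=> _; rewrite lee_fin mulr_ge0 ?expR_ge0.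
have ndg (x : RT) : `]0%R, +oo[%classic x ->
    {homo g^~ x : n k / (n <= k)%N >-> n <= k}.
  rewrite /= in_itv/= andbT => x0 n k nk; rewrite lee_fin ler_wpM2l// ler_expR.
  by rewrite ler_pM2r// lerN2 lef_pV2 ?posrE// ler_nat.
have cv := @cvg_monotone_convergence _ _ _ mu _ mD _ mg g0 ndg.
have -> : \int[mu]_(r in `]0%R, +oo[) (phi r)%:E =
    \int[mu]_(x in `]0%R, +oo[) (fun x0 : RT => limn (g^~ x0)) x.
  apply: eq_integral => x _; apply/esym/cvg_lim => //.
  apply/cvg_EFin; first exact: nearW.
  have cexp : expR (- n.+1%:R^-1 * x)%R @[n --> \oo] --> expR (- 0 * x)%R.
    apply: continuous_cvg; first exact: continuous_expR.
    by apply: cvgMl; apply: cvgN; exact: cvg_harmonic.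
  rewrite oppr0 mul0r expR0 in cexp.
  by rewrite -[phi x]mulr1; apply: cvgM cexp; exact: cvg_cst.
rewrite -(cvg_lim _ cv)//; apply: lime_le; first by apply/cvg_ex; eexists; exact: cv.
by apply: nearW => n; apply: H; rewrite invr_gt0.
Qed.

Lemma spectral_integral_le (lam : {finite_measure set RT -> \bar R}) (m A : R)
    (phi : R -> R) : (0 < m)%R -> lam setT = m%:E -> (forall r, 0 <= phi r)%R ->
  (forall r, \int[lam]_z (1 + cos (z * r))%:E = (m + phi r)%:E) ->
  (0 <= A)%R -> (forall u, (0 < u)%R -> lam `](- u)%R, u[%classic <= (m * A * u)%:E) ->
  \int[mu]_(r in `]0%R, +oo[) (phi r)%:E <= (m * A * (pi / 2))%:E.
Proof.
move=> m0 lamT phi0 phiE A0 lamA.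
apply: integral_damped_le => //; first exact: (measurable_spectral phiE).
move=> s s0; rewrite (spectral_laplace m0 lamT phi0 phiE s0).
have mA0 : (0 <= m * A)%R by rewrite mulr_ge0// ltW.
(* The comparison measure has density m A on the half line only, so it gives ]-t,t[ the mass m A t,
   not 2 m A t: exactly the bound in [lamA]. *)
pose w2 (x : RT) : \bar R := (m * A)%:E * (\1_(`]0%R, +oo[%classic) x)%:E.
have mw2 : measurable_fun setT w2.
  by apply: emeasurable_funM => //; apply/measurable_EFinP; exact: measurable_indic.
have mpois : measurable_fun [set: RT] (fun z : RT => (poisson s z)%:E).
  by apply/measurable_EFinP; exact: measurable_poisson.
have := @poisson_integral_mono R lam mu (cst 1) w2 s s0 _ mw2.
under eq_integral do rewrite mule1.
move=> /(_ _ _ _ _)/le_trans; apply => //.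
- by move=> x; rewrite mule_ge0.
- move=> t t0; under eq_integral do rewrite mule1.
  rewrite integral_indic// setIT (le_trans (lamA t t0))//.
  under eq_integral do rewrite muleCA.
  rewrite ge0_integralZl//; last first.
    by apply: emeasurable_funM; apply/measurable_EFinP; exact: measurable_indic.
  rewrite -integral_in_indic integral_indic//.
  rewrite (_ : _ `&` _ = `]0%R, t[%classic).
    by rewrite /= lebesgue_measure_itv/= lte_fin t0 sube0 -EFinM.
  apply/seteqP; split => x /=; rewrite !in_itv/= andbT.
    by move=> [-> /andP[]].
  by move=> /andP[x0 ->]; rewrite x0 (lt_trans _ x0)// oppr_lt0.
under eq_integral do rewrite muleCA.
rewrite ge0_integralZl//; last 2 first.
- by apply: emeasurable_funM => //; apply/measurable_EFinP; exact: measurable_indic.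
- by move=> x _; rewrite mule_ge0// lee_fin poisson_ge0.
under eq_integral do rewrite muleC.
by rewrite -integral_in_indic integral_poisson// -EFinM.
Qed.

End total_mass_bound.

(** * Moments from Laplace transforms *)

Section finite_FTC.
Context {R : realType}.

Lemma integral_FTC2 (F f : R -> R) (a b : R) : a < b ->
  (forall x, a <= x <= b -> {for x, continuous f}) ->
  (forall x, a <= x <= b -> is_derive x 1 F (f x)) ->
  (\int[@lebesgue_measure R]_(x in `[a, b]) (f x)%:E = (F b - F a)%:E)%E.
Proof.
move=> ab cf dF.
have oo x : x \in `]a, b[ -> a <= x <= b.
  by rewrite in_itv/= => /andP[/ltW -> /ltW ->].
have aab : a <= a <= b by rewrite lexx ltW.
have bab : a <= b <= b by rewrite lexx ltW.
rewrite (@continuous_FTC2 _ f F)//.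
- apply/continuous_within_itvP => //; split.
  + by move=> x /oo; exact: cf.
  + by apply: cvg_at_right_filter; exact: cf.
  + by apply: cvg_at_left_filter; exact: cf.
- split.
  + by move=> x /oo /dF [].
  + by apply: cvg_at_right_filter; apply: is_derive_continuous (dF a aab).
  + by apply: cvg_at_left_filter; apply: is_derive_continuous (dF b bab).
- by move=> x /oo /dF [_ <-]; rewrite derive1E.
Qed.
End finite_FTC.

Section power_kernel.
Local Open Scope ereal_scope.
Context {R : realType}.
Local Notation RT := (measurableTypeR R).
Local Notation mu := (@lebesgue_measure R).

Lemma integral_scale (c : R) (f : R -> \bar R) : (0 < c)%R ->
  measurable_fun [set: R] f -> (forall x, 0 <= f x) ->
  c%:E * (\int[mu]_x f (c * x)%R) = \int[mu]_x f x.
Proof.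
move=> c0 mf f0.
pose c' : {nonneg R} := NngNum (ltW c0).
pose phi : RT -> RT := (fun x => c * x)%R.
have mphi : measurable_fun setT phi by exact: measurable_funM.
pose nu1 : {measure set RT -> \bar R} := pushforward mu phi.
pose nu : {measure set RT -> \bar R} := mscale c' (nu1 mphi).
transitivity (\int[nu]_x f x); last first.
  apply: eq_measure_integral => A mA _.
  rewrite /= /mscale/= /pushforward.
  rewrite -[RHS](@lebesgue_measure_affine _ c 0%R A c0 mA).
  by under [in RHS]eq_fun do rewrite addr0.
rewrite ge0_integral_mscale//; congr (_ * _).
by rewrite (ge0_integral_pushforward mphi mu measurableT mf).
Qed.

(** For p < 1 the integrand is singular at 0, so the antiderivative is used on [[e n, T]] and [e n]
    tends to 0. *)
Lemma integral_powR (p T : R) : (0 < p)%R -> (0 <= T)%R ->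
  \int[mu]_(r in `]0%R, T]) (r `^ (p - 1))%:E = (T `^ p / p)%:E.
Proof.
move=> p0; rewrite le_eqVlt => /predU1P[<-|T0].
  by rewrite set_itv_ge ?bnd_simp ?ltxx// integral_set0 powR0 ?gt_eqF// mul0r.
(* [n.+2] keeps [e n] strictly below [T] already for n = 0. *)
pose e n : R := (T * n.+2%:R^-1)%R.
have e0 n : (0 < e n)%R by rewrite mulr_gt0// invr_gt0.
have eT n : (e n < T)%R by rewrite /e ltr_pdivrMr// ltr_pMr// ltr1n.
pose F n : set RT := `[e n, T]%classic.
have ndF : nondecreasing_seq F.
  move=> n k nk; apply/subsetPset; apply: subset_itvr; rewrite bnd_simp.
  by rewrite ler_pM2l// lef_pV2 ?posrE// ler_nat !ltnS.
have FE : \bigcup_n F n = `]0%R, T]%classic.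
  apply/seteqP; split => [x [n _]|x]; rewrite /F /= !in_itv/= => /andP[x0 xT].
    by rewrite xT (lt_le_trans (e0 n)).
  have [n _ /(_ n (leqnn n)) /= H] := near_infty_natSinv_lt (PosNum (divr_gt0 x0 T0)).
  exists n => //; rewrite /F /= in_itv/= xT andbT.
  rewrite /e mulrC -ler_pdivlMr// ltW// (le_lt_trans _ H)//.
  by rewrite lef_pV2 ?posrE// ler_nat.
have mpow : measurable_fun [set: RT] (fun r : RT => (r `^ (p - 1))%:E).
  by apply/measurable_EFinP; exact: measurable_powR.
have cv : \int[mu]_(x in F n) (x `^ (p - 1))%:E @[n --> \oo] -->
    \int[mu]_(x in \bigcup_n F n) (x `^ (p - 1))%:E.
  apply: ge0_nondecreasing_set_cvg_integral => //.
  - by move=> n; exact: measurable_itv.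
  - by move=> n; exact: measurable_funTS.
  - by move=> n x _; rewrite lee_fin powR_ge0.
rewrite FE in cv; apply/esym; apply: cvg_unique cv => //.
have dF (x : R) : (0 < x)%R ->
    is_derive x (1 : R)%R (fun x => p^-1 * x `^ p)%R (x `^ (p - 1))%R.
  move=> x0.
  apply: (is_derive_eq (is_deriveZ p^-1 (is_derive1_powR p x0))).
  by rewrite /GRing.scale/= mulrA mulVf ?mul1r// gt_eqF.
have IF n : \int[mu]_(x in F n) (x `^ (p - 1))%:E =
    (T `^ p / p - p^-1 * e n `^ p)%:E.
  have dFn (x : R) : (e n <= x <= T)%R ->
      is_derive x (1 : R)%R (fun x => p^-1 * x `^ p)%R (x `^ (p - 1))%R.
    by move=> /andP[ex _]; apply: dF; exact: lt_le_trans (e0 n) ex.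
  rewrite (@integral_FTC2 R (fun x => p^-1 * x `^ p)%R (fun x => x `^ (p - 1))%R)//.
  - by rewrite [(p^-1 * T `^ p)%R]mulrC.
  - move=> x /andP[ex _]; have x0 := lt_le_trans (e0 n) ex.
    exact: is_derive_continuous (is_derive1_powR (p - 1) x0).
rewrite (_ : (fun n => _) = (fun n => (T `^ p / p - p^-1 * e n `^ p)%:E)); last first.
  by apply/funext => n; exact: IF.
apply/cvg_EFin; first exact: nearW.
rewrite -[X in _ --> X]subr0; apply: cvgB; first exact: cvg_cst.
rewrite -(mulr0 (p^-1)%R); apply: cvgMr.
have e_cvg0 : e n @[n --> \oo] --> 0%R.
  rewrite -(mulr0 T); apply: cvgMr.
  by have := @cvg_harmonic R; rewrite -cvg_shiftS.
have /cvg_at_rightP := @powR_cvg0 R p p0.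
exact.
Qed.
End power_kernel.

Section laplace_order.
Local Open Scope ereal_scope.
Context {R : realType}.
Local Notation RT := (measurableTypeR R).
Local Notation mu := (@lebesgue_measure R).
Let pos : set RT := `]0%R, +oo[%classic.

Let mpos : measurable pos. Proof. exact: measurable_itv. Qed.

Lemma measurable_powR_expR (p r : R) :
  measurable_fun [set: RT] (fun s : RT => (s `^ (- p) * expR (- s * r))%:E).
Proof.
apply/measurable_EFinP; apply: measurable_funM; first exact: measurable_powR.
by apply: measurableT_comp => //; apply: measurable_funM.
Qed.

(** The integral is Gamma(1 - p): up to 1 the integrand is at most s^(-p), beyond 1 at most exp(-s).
    The factor [* 1] makes it the case r = 1 of [powR_laplace]. *)
Lemma gamma_fin (p : R) : (0 < p < 1)%R -> exists2 C : R, (0 < C)%R &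
  \int[mu]_(s in `]0%R, +oo[) (s `^ (- p) * expR (- s * 1))%:E = C%:E.
Proof.
move=> /andP[p0 p1]; set I := integral _ _ _.
have f0 (s : R) : (0 <= s `^ (- p) * expR (- s * 1))%R.
  by rewrite mulr_ge0 ?powR_ge0 ?expR_ge0.
have mf D : measurable_fun D (fun s : RT => (s `^ (- p) * expR (- s * 1))%:E).
  by apply: measurable_funTS; exact: measurable_powR_expR.
have m1 : measurable (`]0%R, 1%R]%classic : set RT) by exact: measurable_itv.
have I_lty : I < +oo.
  pose g1 (s : RT) := (\1_(`]0%R, 1%R]%classic : set RT) s)%:E * (s `^ ((1 - p) - 1))%:E.
  pose g2 (s : RT) := (\1_pos s)%:E * (expR (- 1 * s))%:E.
  apply: (@le_lt_trans _ _ (\int[mu]_x (g1 x + g2 x))).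
    rewrite /I integral_in_indic; apply: ge0_le_integral => //.
    - by move=> s _; rewrite mule_ge0// lee_fin.
    - by apply: emeasurable_funM => //; apply/measurable_EFinP; exact: measurable_indic.
    - apply: emeasurable_funD; apply: emeasurable_funM.
      + by apply/measurable_EFinP; exact: measurable_indic.
      + by apply/measurable_EFinP; exact: measurable_powR.
      + by apply/measurable_EFinP; exact: measurable_indic.
      + exact: measurable_expRM.
    - move=> s _; rewrite /g1 /g2 /pos !indicE !mem_setE !in_itv/= !andbT.
      have [s0|s0] := ltP 0%R s; last by rewrite !mul0e adde0.
      rewrite !mul1e mulr1 mulN1r; have [s1|s1] := leP s 1%R; rewrite /= ?mul1e.
        rewrite -EFinD lee_fin addrAC subrr add0r.
        rewrite ler_wpDr ?expR_ge0// ler_piMr ?powR_ge0//.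
        by rewrite -expR0 ler_expR oppr_le0 ltW.
      rewrite mul0e add0e lee_fin ler_piMl ?expR_ge0//.
      by rewrite -(powRr0 s) ler_powR ?ltW// oppr_lt0.
  rewrite ge0_integralD//; last 4 first.
  - by move=> s _; rewrite mule_ge0// lee_fin ?powR_ge0.
  - apply: emeasurable_funM.
    + by apply/measurable_EFinP; exact: measurable_indic.
    + by apply/measurable_EFinP; exact: measurable_powR.
  - by move=> s _; rewrite mule_ge0// lee_fin ?expR_ge0.
  - apply: emeasurable_funM; last exact: measurable_expRM.
    by apply/measurable_EFinP; exact: measurable_indic.
  rewrite -!integral_in_indic integral_powR// ?subr_gt0//.
  by rewrite (laplace_one ltr01) -EFinD ltry.
have I_gt0 : 0 < I.
  apply: (@lt_le_trans _ _ (\int[mu]_(s in `]0%R, 1%R]) (cst (expR (-1))%:E s))).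
    rewrite integral_cst//= lebesgue_measure_itv/= lte_fin ltr01 sube0 mule1.
    by rewrite lte_fin expR_gt0.
  apply: (@le_trans _ _ (\int[mu]_(s in `]0%R, 1%R]) (s `^ (- p) * expR (- s * 1))%:E)).
    apply: ge0_le_integral => // s; rewrite /= in_itv/= => /andP[s0 s1]; rewrite lee_fin.
      by rewrite expR_ge0.
    apply: (@le_trans _ _ (1 * expR (- s * 1))%R).
      by rewrite mul1r ler_expR mulr1 lerN2.
    rewrite ler_wpM2r ?expR_ge0// -(powRr0 s).
    by apply: ger_powR; rewrite ?s0// oppr_le0 ltW.
  apply: ge0_subset_integral => //.
    by move=> s _; rewrite lee_fin.
  by apply: subset_itvl.
exists (fine I); first by rewrite fine_gt0// I_gt0.
by rewrite fineK// ge0_fin_numE// ltW.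
Qed.

(** [C] is Gamma(1 - p), and the power of r comes from the substitution of r s for s in its
    integral. *)
Lemma powR_laplace (p : R) : (0 < p < 1)%R -> exists2 C : R, (0 < C)%R &
  forall r, (0 < r)%R ->
  \int[mu]_(s in `]0%R, +oo[) (s `^ (- p) * expR (- s * r))%:E =
  (C * r `^ (p - 1))%:E.
Proof.
move=> p01; have [C C0 CE] := gamma_fin p01; exists C => // r r0.
pose f (s : R) : \bar R :=
  (\1_pos s)%:E * (s `^ (- p) * expR (- s * 1))%:E.
have mf : measurable_fun [set: R] f.
  apply: emeasurable_funM; last exact: measurable_powR_expR.
  by apply/measurable_EFinP; exact: measurable_indic.
have f0 s : 0 <= f s.
  by rewrite mule_ge0// lee_fin mulr_ge0 ?powR_ge0 ?expR_ge0.
have := integral_scale r0 mf f0.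
rewrite {2}/f -[in RHS]integral_in_indic [X in _ = X]CE.
have -> : \int[mu]_s f (r * s)%R = (r `^ (- p))%:E *
    \int[mu]_(s in `]0%R, +oo[) (s `^ (- p) * expR (- s * r))%:E.
  rewrite [in RHS]integral_in_indic -ge0_integralZl//; last 3 first.
  - apply: emeasurable_funM; last exact: measurable_powR_expR.
    by apply/measurable_EFinP; exact: measurable_indic.
  - by move=> s _; rewrite mule_ge0// lee_fin mulr_ge0 ?powR_ge0 ?expR_ge0.
  - by rewrite lee_fin powR_ge0.
  apply: eq_integral => s _; rewrite /f /pos !indicE !mem_setE !in_itv/= !andbT.
  rewrite pmulr_rgt0//; have [s0|_] := ltP 0%R s; last by rewrite !mul0e mule0.
  rewrite !mul1e -EFinM powRM ?ltW// mulr1 mulrA; congr (_ * expR _)%:E.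
  by rewrite mulNr mulrC.
have rp : (r * r `^ (- p) = r `^ (1 - p))%R.
  by rewrite powRD ?powRr1 ?ltW//; apply/implyP => _; rewrite gt_eqF.
rewrite muleA -EFinM rp => H.
have rp0 : (r `^ (p - 1) * r `^ (1 - p) = 1)%R.
  rewrite -powRD; last by apply/implyP => _; rewrite gt_eqF.
  by rewrite (_ : p - 1 + (1 - p) = 0)%R ?powRr0//; ring.
by rewrite mulrC EFinM -H muleA -EFinM rp0 mul1e.
Qed.

Lemma laplace_order_powR (p : R) (g1 g2 : R -> R) : (0 < p < 1)%R ->
  measurable_fun [set: R] g1 -> measurable_fun [set: R] g2 ->
  (forall r, 0 <= g1 r)%R -> (forall r, 0 <= g2 r)%R ->
  (forall s, (0 < s)%R ->
    \int[mu]_(r in `]0%R, +oo[) (g1 r * expR (- s * r))%:E <=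
    \int[mu]_(r in `]0%R, +oo[) (g2 r * expR (- s * r))%:E) ->
  \int[mu]_(r in `]0%R, +oo[) (g1 r * r `^ (p - 1))%:E <=
  \int[mu]_(r in `]0%R, +oo[) (g2 r * r `^ (p - 1))%:E.
Proof.
move=> p01 mg1 mg2 g10 g20 H; have [C C0 CE] := powR_laplace p01.
have mexp (s : R) (D : set RT) : measurable_fun D (fun r : RT => (expR (- s * r))%:E).
  by apply: measurable_funTS; exact: measurable_expRM.
(* Integrating the Laplace transform of [g] against s^(-p) and exchanging integrals gives [C] times
   the p-th moment of [g]. The weight is non-negative, so the order of the Laplace transforms
   carries over. *)
have mix (g : R -> R) : measurable_fun [set: R] g -> (forall r, 0 <= g r)%R ->
    \int[mu]_(s in `]0%R, +oo[) ((s `^ (- p))%:E *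
      \int[mu]_(r in `]0%R, +oo[) (g r * expR (- s * r))%:E) =
    C%:E * \int[mu]_(r in `]0%R, +oo[) (g r * r `^ (p - 1))%:E.
  move=> mg g0.
  transitivity (\int[mu]_(s in `]0%R, +oo[) \int[mu]_(r in `]0%R, +oo[)
      ((s `^ (- p))%:E * (g r * expR (- s * r))%:E)).
    apply: eq_integral => s _; rewrite ge0_integralZl//.
    - apply/measurable_EFinP; apply: measurable_funM; first exact: measurable_funTS.
      by apply/measurable_EFinP; exact: mexp.
    - by move=> r _; rewrite lee_fin mulr_ge0 ?expR_ge0.
    - by rewrite lee_fin powR_ge0.
  rewrite (@tonelli_in _ _ _ RT RT mu mu pos pos (fun s r =>
      (s `^ (- p))%:E * (g r * expR (- s * r))%:E))//; last 2 first.
  - apply: emeasurable_funM; apply/measurable_EFinP.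
      exact: (measurableT_comp (measurable_powR _)).
    apply: measurable_funM; first exact: measurableT_comp.
    apply: measurableT_comp => //; apply: measurable_funM => //.
    exact: measurableT_comp.
  - by move=> s r; rewrite mule_ge0// lee_fin ?powR_ge0// mulr_ge0 ?expR_ge0.
  rewrite -ge0_integralZl//; last 3 first.
  - apply/measurable_EFinP; apply: measurable_funM; first exact: measurable_funTS.
    by apply: measurable_funTS; exact: measurable_powR.
  - by move=> r _; rewrite lee_fin mulr_ge0 ?powR_ge0.
  - by rewrite lee_fin ltW.
  apply: eq_integral => r; rewrite inE /pos/= in_itv/= andbT => r0.
  transitivity (\int[mu]_(s in pos)
      ((g r)%:E * (s `^ (- p) * expR (- s * r))%:E)).
    by apply: eq_integral => s _; rewrite -!EFinM; congr EFin; ring.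
  rewrite ge0_integralZl//; last 3 first.
  - by apply: measurable_funTS; exact: measurable_powR_expR.
  - by move=> s _; rewrite lee_fin mulr_ge0 ?powR_ge0 ?expR_ge0.
  - by rewrite lee_fin.
  by rewrite CE// -!EFinM; congr EFin; ring.
have mlap (g : R -> R) : measurable_fun [set: R] g -> (forall r, 0 <= g r)%R ->
    measurable_fun [set: RT] (fun s : RT =>
      \int[mu]_(r in `]0%R, +oo[) (g r * expR (- s * r))%:E).
  move=> mg g0.
  have := @measurable_fun_fubini_tonelli_F _ _ RT RT R mu (fun q =>
    (\1_pos q.2)%:E * (g q.2 * expR (- q.1 * q.2))%:E).
  rewrite /fubini_F/= => mF.
  rewrite (_ : (fun s => _) = (fun x => \int[mu]_y
      ((\1_pos y)%:E * (g y * expR (- x * y))%:E))).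
    apply: mF.
      apply: emeasurable_funM; apply/measurable_EFinP.
        by apply: measurableT_comp => //; exact: measurable_indic.
      apply: measurable_funM; first exact: measurableT_comp.
      apply: measurableT_comp => //; apply: measurable_funM => //.
      exact: measurableT_comp.
    by move=> q; rewrite mule_ge0// lee_fin mulr_ge0 ?expR_ge0.
  by apply/funext => s; rewrite integral_in_indic.
rewrite -(@lee_pmul2l _ C%:E)// -!mix//; apply: ge0_le_integral => //.
- move=> s _; rewrite mule_ge0// ?lee_fin ?powR_ge0//.
  by apply: integral_ge0 => r _; rewrite lee_fin mulr_ge0 ?expR_ge0.
- apply: measurable_funTS; apply: emeasurable_funM; last exact: mlap.
  by apply/measurable_EFinP; exact: measurable_powR.
- apply: measurable_funTS; apply: emeasurable_funM; last exact: mlap.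
  by apply/measurable_EFinP; exact: measurable_powR.
- move=> s; rewrite /= in_itv/= andbT => s0.
  by rewrite lee_wpmul2l// ?lee_fin ?powR_ge0// H.
Qed.

End laplace_order.

(** * Lower bound for the moments of a^2 / (a^2 + r^2) *)

Section cauchy_moment.
Context {R : realType}.
Local Notation RT := (measurableTypeR R).
Local Notation mu := (@lebesgue_measure R).
Variable a : R.
Hypothesis a0 : 0 < a.

Let D (r : R) := a ^+ 2 + r ^+ 2.

Let D0 r : 0 < D r. Proof. exact: poisson_denom_gt0. Qed.

Let dD (r : R) : is_derive r 1 D (2 * r).
Proof.
have h := is_deriveD (is_derive_cst (a ^+ 2) r 1) (is_deriveX 2 (is_derive_id r 1)).
apply: (is_derive_eq h); rewrite add0r /GRing.scale/=. ring.
Qed.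

Let dlnD (r : R) : is_derive r 1 (fun r => 2^-1 * ln (D r)) (r / D r).
Proof.
have h := @is_derive1_comp R (@ln R) D r _ _ (is_derive1_ln (D0 r)) (dD r).
apply: (is_derive_eq (is_deriveZ 2^-1 h)).
by rewrite /GRing.scale/=; field; rewrite gt_eqF.
Qed.

Let cD (r : R) : {for r, continuous D}.
Proof. exact: is_derive_continuous (dD r). Qed.

Let cinvD (r : R) : {for r, continuous (fun r => (D r)^-1)}.
Proof. by apply: (@continuousV _ _ D); [rewrite gt_eqF|exact: cD]. Qed.

Let ctail (x : R) : 0 < x -> {for x, continuous (fun r : R => a ^+ 2 / (r * D r))}.
Proof.
move=> x0.
apply: (@continuousM _ _ (cst (a ^+ 2)) (fun r : R => (r * D r)^-1)).
  exact: cst_continuous.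
apply: (@continuousV _ _ (fun r : R => r * D r)); first by rewrite mulf_neq0// gt_eqF.
by apply: (@continuousM _ _ id D); [exact: cvg_id|exact: cD].
Qed.

Lemma integral_cauchy_head :
  (\int[mu]_(r in `]0%R, a]) (r / D r)%:E = (2^-1 * ln 2)%:E)%E.
Proof.
rewrite integral_itv_obnd_cbnd; last first.
  apply/measurable_EFinP/measurable_funTS; apply: continuous_measurable_fun => x.
  by apply: (@continuousM _ _ id (fun r : R => (D r)^-1)); [exact: cvg_id|exact: cinvD].
have dl (x : R) : 0 <= x <= a -> is_derive x 1 (fun r => 2^-1 * ln (D r)) (x / D x).
  by move=> _.
rewrite (@integral_FTC2 R (fun r => 2^-1 * ln (D r)) (fun r => r / D r) 0 a)//.
  congr EFin; rewrite /D expr0n addr0 -mulrBr -ln_div ?posrE ?exprn_gt0//; last exact: D0.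
  by congr (_ * ln _); field; rewrite gt_eqF.
move=> x _.
by apply: (@continuousM _ _ id (fun r : R => (D r)^-1)); [exact: cvg_id|exact: cinvD].
Qed.

Lemma integral_cauchy_tail :
  (\int[mu]_(r in `]a, +oo[) (a ^+ 2 / (r * D r))%:E = (2^-1 * ln 2)%:E)%E.
Proof.
have dF (x : R) : a <= x ->
    is_derive x 1 (fun r => ln r - 2^-1 * ln (D r)) (a ^+ 2 / (x * D x)).
  move=> ax; have x0 := lt_le_trans a0 ax.
  apply: (is_derive_eq (is_deriveB (is_derive1_ln x0) (dlnD x))).
  by rewrite /D; field; rewrite !gt_eqF//; exact: D0.
rewrite (@integral_FTC2y R (fun r => ln r - 2^-1 * ln (D r))
  (fun r => a ^+ 2 / (r * D r)) a 0)//.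
- have Da : D a = a * a * 2 by rewrite /D; ring.
  by congr EFin; rewrite sub0r opprB Da !lnM ?posrE ?mulr_gt0//; field.
- move=> x ax; have x0 := lt_le_trans a0 ax.
  by rewrite divr_ge0// ?sqr_ge0// mulr_ge0// ltW.
- by move=> x ax; apply: ctail; exact: lt_le_trans a0 ax.
- have h0 : a * r^-1 @[r --> +oo] --> a * 0.
    apply: cvgMr; apply/gtr0_cvgV0; last exact: cvg_id.
    exact: nbhs_pinfty_gt.
  have h1 : 1 + (a * r^-1) ^+ 2 @[r --> +oo] --> (1 : R).
    rewrite -[X in _ --> X]addr0 -[X in _ --> _ + X](mulr0 (a * 0)).
    apply: cvgD; first exact: cvg_cst.
    by rewrite -{2}(mulr0 a); apply: cvgM.
  have H : - (2^-1 * ln (1 + (a * r^-1) ^+ 2)) @[r --> +oo] --> 0.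
    rewrite -oppr0 -(mulr0 2^-1) -(@ln1 R); apply: cvgN; apply: cvgMr.
    exact: (cvg_comp _ _ h1 (continuous_ln ltr01)).
  apply: cvg_trans H; apply: near_eq_cvg; near=> r.
  have r0 : 0 < r by near: r; exact: nbhs_pinfty_gt.
  rewrite (_ : D r = r ^+ 2 * (1 + (a / r) ^+ 2)).
    rewrite lnM ?posrE ?exprn_gt0//; last by rewrite ltr_wpDr ?sqr_ge0.
    by rewrite lnXn//; field.
  by rewrite /D; field; rewrite gt_eqF.
Unshelve. all: by end_near. Qed.

(** The exact value is a^p pi / (2 sin(pi p / 2)), but a comparison with 1_]0,a] suffices, whose
    moment is a^p / p. On ]0,a] the loss is r^p r / D(r) <= a^p r / D(r); on ]a,+oo[ the gain is r^p
    a^2 / (r D(r)) >= a^p a^2 / (r D(r)). Both bounds integrate to a^p (ln 2) / 2. *)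
Lemma cauchy_moment_ge (p : R) : 0 < p < 1 ->
  ((a `^ p / p)%:E <=
   \int[mu]_(r in `]0%R, +oo[) (a ^+ 2 / D r * r `^ (p - 1))%:E)%E.
Proof.
move=> /andP[p0 p1].
have f0 (r : R) : 0 <= a ^+ 2 / D r * r `^ (p - 1).
  by rewrite mulr_ge0 ?powR_ge0// divr_ge0 ?sqr_ge0// ltW.
have mD : measurable_fun [set: RT] (fun r : RT => (D r)^-1).
  by apply: continuous_measurable_fun => x; exact: cinvD.
have mf (A : set RT) : measurable_fun A
    (fun r : RT => (a ^+ 2 / D r * r `^ (p - 1))%:E).
  apply/measurable_EFinP/measurable_funTS; apply: measurable_funM.
    exact: measurable_funM.
  exact: measurable_powR.
have mh (A : set RT) : measurable_fun A (fun r : RT => (r / D r)%:E).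
  by apply/measurable_EFinP/measurable_funTS; exact: measurable_funM.
have -> : `]0%R, +oo[%classic = `]0%R, a]%classic `|` `]a, +oo[%classic :> set RT.
  rewrite -itv_bndbnd_setU//; by rewrite bnd_simp ltW.
rewrite ge0_integral_setU//=; last 2 first.
- by move=> x _; rewrite lee_fin.
- apply/disj_setPS => x [/=]; rewrite !in_itv/= andbT => /andP[_ xa].
  by move=> /lt_le_trans /(_ xa); rewrite ltxx.
have head : ((a `^ p / p)%:E <= \int[mu]_(r in `]0%R, a])
    (a ^+ 2 / D r * r `^ (p - 1))%:E + (a `^ p * (2^-1 * ln 2))%:E)%E.
  rewrite [X in (_ <= _ + X)%E]EFinM -integral_cauchy_head -ge0_integralZl//; last 2 first.
  - by move=> r; rewrite /= in_itv/= => /andP[r0 _]; rewrite lee_fin divr_ge0// ltW.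
  - by rewrite lee_fin powR_ge0.
  rewrite -ge0_integralD//; last 3 first.
  - by move=> r _; rewrite lee_fin.
  - move=> r; rewrite /= in_itv/= => /andP[r0 _].
    by rewrite mule_ge0// lee_fin ?powR_ge0// divr_ge0// ltW.
  - exact: emeasurable_funM.
  rewrite -(integral_powR p0 (ltW a0)); apply: ge0_le_integral => //.
  - by move=> r _; rewrite lee_fin powR_ge0.
  - by apply/measurable_EFinP/measurable_funTS; exact: measurable_powR.
  - by apply: emeasurable_funD => //; exact: emeasurable_funM.
  move=> r; rewrite /= in_itv/= => /andP[r0 ra]; rewrite -EFinM -EFinD lee_fin.
  have rpE : r `^ (p - 1) = r `^ p / r.
    by rewrite powRB ?powRr1 ?ltW//; apply/implyP => _; rewrite gt_eqF.
  have rp_le : r `^ p <= a `^ p.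
    by apply: ge0_ler_powR => //; rewrite ?nnegrE ltW.
  rewrite -subr_ge0 rpE.
  have -> : a ^+ 2 / D r * (r `^ p / r) + a `^ p * (r / D r) - r `^ p / r =
      (a `^ p - r `^ p) * (r / D r).
    by rewrite /D; field; rewrite !gt_eqF//; exact: D0.
  by rewrite mulr_ge0 ?subr_ge0// divr_ge0// ltW.
have mt : measurable_fun (`]a, +oo[%classic : set RT)
    (fun r : RT => (a ^+ 2 / (r * D r))%:E).
  apply/measurable_EFinP; apply: open_continuous_measurable_fun => //.
  by move=> x; rewrite inE/= in_itv/= andbT => ax; apply: ctail; exact: lt_trans a0 ax.
apply: (le_trans head); apply: leeD2l.
rewrite [X in (X <= _)%E]EFinM -integral_cauchy_tail -ge0_integralZl//; last 2 first.
- move=> r; rewrite /= in_itv/= andbT => ar; have r0 := lt_trans a0 ar.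
  by rewrite lee_fin divr_ge0 ?sqr_ge0// mulr_ge0// ltW.
- by rewrite lee_fin powR_ge0.
apply: ge0_le_integral => //.
- move=> r; rewrite /= in_itv/= andbT => ar; have r0 := lt_trans a0 ar.
  by rewrite mule_ge0// lee_fin ?powR_ge0// divr_ge0 ?sqr_ge0// mulr_ge0// ltW.
- exact: emeasurable_funM.
move=> r; rewrite /= in_itv/= andbT => ar; have r0 := lt_trans a0 ar.
have rpE : r `^ (p - 1) = r `^ p / r.
  by rewrite powRB ?powRr1 ?ltW//; apply/implyP => _; rewrite gt_eqF.
have rp_le : a `^ p <= r `^ p.
  by apply: ge0_ler_powR => //; rewrite ?nnegrE ltW.
rewrite -EFinM lee_fin rpE.
have -> : a ^+ 2 / D r * (r `^ p / r) = r `^ p * (a ^+ 2 / (r * D r)).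
  by rewrite /D; field; rewrite !gt_eqF//; exact: D0.
by rewrite ler_wpM2r// divr_ge0 ?sqr_ge0// mulr_ge0// ltW.
Qed.

End cauchy_moment.

Section moment_lower_bound.
Local Open Scope ereal_scope.
Context {R : realType}.
Local Notation RT := (measurableTypeR R).
Local Notation mu := (@lebesgue_measure R).

Lemma ge0_integral_itv0yZ (c : R) (f : R -> R) : (0 <= c)%R ->
  measurable_fun [set: R] f -> (forall x, 0 <= f x)%R ->
  \int[mu]_(x in `]0%R, +oo[) (c * f x)%:E =
  c%:E * \int[mu]_(x in `]0%R, +oo[) (f x)%:E.
Proof.
move=> c0 mf f0; under eq_integral do rewrite EFinM.
apply: ge0_integralZl => //.
- exact/measurable_EFinP/measurable_funTS.
- by move=> x _; rewrite lee_fin.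
Qed.

Lemma ge0_integral_itv0yD (f g : R -> R) :
  measurable_fun [set: R] f -> measurable_fun [set: R] g ->
  (forall x, 0 <= f x)%R -> (forall x, 0 <= g x)%R ->
  \int[mu]_(x in `]0%R, +oo[) (f x + g x)%:E =
  \int[mu]_(x in `]0%R, +oo[) (f x)%:E + \int[mu]_(x in `]0%R, +oo[) (g x)%:E.
Proof.
move=> mf mg f0 g0; under eq_integral do rewrite EFinD.
apply: ge0_integralD => //.
- by move=> x _; rewrite lee_fin.
- exact/measurable_EFinP/measurable_funTS.
- by move=> x _; rewrite lee_fin.
- exact/measurable_EFinP/measurable_funTS.
Qed.

Let mexp (c : R) : measurable_fun [set: RT] (fun r : RT => expR (- c * r)).
Proof. by apply/measurable_EFinP; exact: measurable_expRM. Qed.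

Let e0 (c r : R) : (0 <= expR (- c * r))%R. Proof. exact: expR_ge0. Qed.

Let cos1_ge0 (t : R) : (0 <= 1 + cos t)%R.
Proof. by rewrite -lerBlDl sub0r cos_geN1. Qed.

Let mdc (c t : R) :
  measurable_fun [set: RT] (fun r : RT => expR (- c * r) * (1 + cos (t * r)))%R.
Proof.
apply/measurable_EFinP.
exact: (@measurable_damped_cos R _ RT c id (cst t) (@measurable_id _ _ _) (measurable_cst _)).
Qed.

(** a^2 / (a^2 + r^2) is the cosine transform of the density a exp(-a t) on the half line, and
    [poisson s t] the Laplace transform of cos(t r). Each side plus 1/s is the double integral of
    [F], in one of the two orders. *)
Lemma laplace_cauchy (a s : R) : (0 < a)%R -> (0 < s)%R ->
  \int[mu]_(t in `]0%R, +oo[) (a * expR (- a * t) * poisson s t)%:E =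
  \int[mu]_(r in `]0%R, +oo[) (a ^+ 2 / (a ^+ 2 + r ^+ 2) * expR (- s * r))%:E.
Proof.
move=> a0 s0; have a0' := ltW a0; have s0' := ltW s0.
have an0 : a != 0%R by rewrite gt_eqF.
have sn0 : s != 0%R by rewrite gt_eqF.
pose F (t r : R) := (a * expR (- a * t) * (expR (- s * r) * (1 + cos (t * r))))%R.
have F0 t r : (0 <= F t r)%R.
  by apply: mulr_ge0; [exact: mulr_ge0|exact: mulr_ge0].
have ah0 r : (0 <= a ^+ 2 / (a ^+ 2 + r ^+ 2))%R.
  by apply: divr_ge0; [exact: sqr_ge0|exact: ltW (poisson_denom_gt0 r a0)].
have swap : \int[mu]_(t in `]0%R, +oo[) \int[mu]_(r in `]0%R, +oo[) (F t r)%:E =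
    \int[mu]_(r in `]0%R, +oo[) \int[mu]_(t in `]0%R, +oo[) (F t r)%:E.
  apply: (@tonelli_in _ _ _ RT RT mu mu _ _ (fun t r => (F t r)%:E)).
  - exact: measurable_itv.
  - exact: measurable_itv.
  - apply/measurable_EFinP; apply: measurable_funM; last first.
      apply/measurable_EFinP.
      exact: (measurable_damped_cos s measurable_snd measurable_fst).
    apply: measurable_funM; first exact: measurable_cst.
    exact: (measurableT_comp (mexp a) measurable_fst).
  - by move=> t r; rewrite lee_fin.
have lhs : \int[mu]_(t in `]0%R, +oo[) \int[mu]_(r in `]0%R, +oo[) (F t r)%:E =
    s^-1%:E +
    \int[mu]_(t in `]0%R, +oo[) (a * expR (- a * t) * poisson s t)%:E.
  transitivity (\int[mu]_(t in `]0%R, +oo[)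
      (a / s * expR (- a * t) + a * expR (- a * t) * poisson s t)%:E).
    apply: eq_integral => t _; rewrite ge0_integral_itv0yZ; last 3 first.
    - exact: mulr_ge0.
    - exact: mdc.
    - by move=> r; exact: mulr_ge0.
    rewrite laplace_cos ?s0// -EFinM; congr EFin; rewrite /poisson.
    by rewrite mulrDr mulrAC.
  rewrite ge0_integral_itv0yD; last 4 first.
  - by apply: measurable_funM; [exact: measurable_cst|exact: mexp].
  - apply: measurable_funM; last exact: measurable_poisson.
    by apply: measurable_funM; [exact: measurable_cst|exact: mexp].
  - by move=> t; apply: mulr_ge0 => //; exact: divr_ge0.
  - by move=> t; apply: mulr_ge0; [exact: mulr_ge0|exact: poisson_ge0].
  rewrite ge0_integral_itv0yZ; last 3 first.
  - exact: divr_ge0.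
  - exact: mexp.
  - exact: e0.
  by rewrite laplace_one// -EFinM mulrAC divff// mul1r.
have rhs : \int[mu]_(r in `]0%R, +oo[) \int[mu]_(t in `]0%R, +oo[) (F t r)%:E =
    s^-1%:E + \int[mu]_(r in `]0%R, +oo[)
      (a ^+ 2 / (a ^+ 2 + r ^+ 2) * expR (- s * r))%:E.
  transitivity (\int[mu]_(r in `]0%R, +oo[)
      (expR (- s * r) + a ^+ 2 / (a ^+ 2 + r ^+ 2) * expR (- s * r))%:E).
    apply: eq_integral => r _.
    transitivity (\int[mu]_(t in `]0%R, +oo[)
        (a * expR (- s * r) * (expR (- a * t) * (1 + cos (r * t))))%:E).
      apply: eq_integral => t _; congr EFin; rewrite /F [(t * r)%R]mulrC.
      by rewrite !mulrA [(a * _ * _)%R]mulrAC.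
    rewrite ge0_integral_itv0yZ; last 3 first.
    - exact: mulr_ge0.
    - exact: mdc.
    - by move=> t; exact: mulr_ge0.
    rewrite laplace_cos ?a0// -EFinM; congr EFin.
    rewrite mulrDr mulrAC divff// mul1r; congr (_ + _)%R.
    by rewrite mulrAC mulrA -expr2.
  rewrite ge0_integral_itv0yD; last 4 first.
  - exact: mexp.
  - apply: measurable_funM; last exact: mexp.
    rewrite (_ : (fun r => _) = (fun r : RT => a * poisson a r)%R).
      by apply: measurable_funM; [exact: measurable_cst|exact: measurable_poisson].
    by apply/funext => r; rewrite /poisson expr2 mulrA.
  - exact: e0.
  - by move=> r; exact: mulr_ge0.
  by rewrite laplace_one.
by apply: (@adde_EFin_inj R s^-1); rewrite -lhs -rhs.
Qed.

Lemma spectral_moment_ge (lam : {finite_measure set RT -> \bar R}) (m a p : R)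
    (phi : R -> R) : (0 < m)%R -> lam setT = m%:E -> (forall r, 0 <= phi r)%R ->
  (forall r, \int[lam]_z (1 + cos (z * r))%:E = (m + phi r)%:E) ->
  (0 < a)%R -> (0 < p < 1)%R ->
  (forall t, (0 < t)%R -> (m * (1 - expR (- a * t)))%:E <= lam `](- t)%R, t[%classic) ->
  (m * (a `^ p / p))%:E <= \int[mu]_(r in `]0%R, +oo[) (phi r * r `^ (p - 1))%:E.
Proof.
move=> m0 lamT phi0 phiE a0 p01 lam_ge; have m0' := ltW m0; have a0' := ltW a0.
pose h (r : R) := (a ^+ 2 / (a ^+ 2 + r ^+ 2))%R.
have mh : measurable_fun [set: R] h.
  rewrite (_ : h = (fun r : RT => a * poisson a r)%R).
    by apply: measurable_funM; [exact: measurable_cst|exact: measurable_poisson].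
  by apply/funext => r; rewrite /h /poisson expr2 mulrA.
have h0 r : (0 <= h r)%R.
  by apply: divr_ge0; [exact: sqr_ge0|exact: ltW (poisson_denom_gt0 r a0)].
apply: (@le_trans _ _ (\int[mu]_(r in `]0%R, +oo[) (m * h r * r `^ (p - 1))%:E)).
  rewrite (_ : \int[mu]_(r in _) _ = \int[mu]_(r in `]0%R, +oo[)
      (m * (h r * r `^ (p - 1)))%:E); last first.
    by apply: eq_integral => r _; rewrite mulrA.
  rewrite ge0_integral_itv0yZ; last 3 first.
  - by [].
  - by apply: measurable_funM => //; exact: measurable_powR.
  - by move=> r; apply: mulr_ge0 => //; exact: powR_ge0.
  by rewrite EFinM lee_pmul2l// cauchy_moment_ge.
apply: laplace_order_powR => //.
- by apply: measurable_funM => //; exact: measurable_cst.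
- exact: (measurable_spectral phiE).
- by move=> r; exact: mulr_ge0.
move=> s s0; have s0' := ltW s0; rewrite (spectral_laplace m0 lamT phi0 phiE s0).
rewrite (_ : \int[mu]_(r in _) _ = \int[mu]_(r in `]0%R, +oo[)
    (m * (h r * expR (- s * r)))%:E); last first.
  by apply: eq_integral => r _; rewrite mulrA.
rewrite ge0_integral_itv0yZ; last 3 first.
- by [].
- by apply: measurable_funM => //; exact: mexp.
- by move=> r; exact: mulr_ge0.
rewrite -laplace_cauchy//.
have maexp : measurable_fun [set: RT] (fun t : RT => a * expR (- a * t))%R.
  by apply: measurable_funM; [exact: measurable_cst|exact: mexp].
have maexpp : measurable_fun [set: RT] (fun t : RT => a * expR (- a * t) * poisson s t)%R.
  by apply: measurable_funM => //; exact: measurable_poisson.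
have aexp0 x : (0 <= a * expR (- a * x))%R by exact: mulr_ge0.
rewrite -ge0_integral_itv0yZ; last 3 first.
- by [].
- by [].
- by move=> t; apply: mulr_ge0 => //; exact: poisson_ge0.
(* The two-sided exponential law of mass [m], folded onto the half line: ]-t,t[ keeps its mass m (1
   - exp(-a t)). *)
pose w (x : RT) : \bar R :=
  (\1_(`]0%R, +oo[%classic : set RT) x)%:E * (m * (a * expR (- a * x)))%:E.
have mw : measurable_fun setT w.
  apply: emeasurable_funM; apply/measurable_EFinP; first exact: measurable_indic.
  by apply: measurable_funM => //; exact: measurable_cst.
have w0 x : 0 <= w x.
  by apply: mule_ge0; rewrite lee_fin//; exact: mulr_ge0.
rewrite (_ : \int[mu]_(r in _) _ = \int[mu]_x ((poisson s x)%:E * w x)); last first.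
  rewrite [LHS]integral_in_indic; apply: eq_integral => t _.
  rewrite /w muleCA; congr (_ * _); rewrite -EFinM; congr EFin.
  by rewrite [RHS]mulrC !mulrA.
rewrite (_ : \int[lam]_z _ = \int[lam]_z ((poisson s z)%:E * cst 1 z)); last first.
  by apply: eq_integral => z _; rewrite mule1.
apply: poisson_integral_mono => // t t0.
rewrite (_ : \int[lam]_x _ = lam `](- t)%R, t[%classic); last first.
  under eq_integral do rewrite mule1.
  by rewrite integral_indic// setIT.
apply: le_trans (lam_ge t t0).
rewrite (_ : \int[mu]_x _ = \int[mu]_(x in `]0%R, t[) (m * (a * expR (- a * x)))%:E).
  have mE : measurable_fun [set: RT] (fun x : RT => (m * (a * expR (- a * x)))%:E).
    by apply/measurable_EFinP; apply: measurable_funM => //; exact: measurable_cst.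
  rewrite -(@integral_itv_bndoo R 0%R t _ true false); last exact: measurable_funTS.
  have dF (x : R) : (0 <= x <= t)%R -> is_derive x (1 : R)%R
      (fun x => - m * expR (- a * x))%R (m * (a * expR (- a * x)))%R.
    move=> _; have d := is_derive_comp_mull (is_derive_expR (- a * x)%R).
    apply: (is_derive_eq (is_deriveZ (- m)%R d)).
    by rewrite /GRing.scale/=; ring.
  rewrite (@integral_FTC2 R (fun x => - m * expR (- a * x))%R
    (fun x => m * (a * expR (- a * x)))%R 0%R t)//.
    by rewrite lee_fin mulr0 expR0; lra.
  move=> x _; have d := is_derive_comp_mull (is_derive_expR (- a * x)%R).
  exact: is_derive_continuous (is_deriveZ m (is_deriveZ a d)).
rewrite [RHS]integral_in_indic; apply: eq_integral => x _.
rewrite /w muleA; congr (_ * _); rewrite -EFinM; congr EFin.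
rewrite !indicE !mem_setE !in_itv/= andbT.
have [x0|x0] := ltP 0%R x; last by rewrite mulr0.
by rewrite mulr1 (lt_trans _ x0)// oppr_lt0.
Qed.

End moment_lower_bound.

(** * Symmetric log-concave measures *)

Section symmetric_logconcave.
Context {R : realType}.
Local Notation RT := (measurableTypeR R).
Variables (lam : {finite_measure set RT -> \bar R}) (m : R).
Hypotheses (m_gt0 : 0 < m) (lamT : lam setT = m%:E).
Hypothesis lam_mid : forall A B C : set RT, measurable A -> measurable B ->
  measurable C -> (forall x y, A x -> B y -> C ((x + y) / 2)) ->
  (lam A * lam B <= lam C * lam C)%E.
Hypothesis lam_sym : forall A : set RT, measurable A -> lam (-%R @^-1` A) = lam A.

Let L (A : set RT) : R := fine (lam A).

Let lamE (A : set RT) : measurable A -> lam A = (L A)%:E.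
Proof. by move=> mA; rewrite /L fineK// fin_num_measure. Qed.

Let L_ge0 (A : set RT) : 0 <= L A. Proof. exact: fine_ge0. Qed.

Let L_mono (A B : set RT) : measurable A -> measurable B -> A `<=` B -> L A <= L B.
Proof. by move=> mA mB AB; rewrite -lee_fin -!lamE//; exact: measure_mono. Qed.

Let L_mid (A B C : set RT) : measurable A -> measurable B -> measurable C ->
  (forall x y, A x -> B y -> C ((x + y) / 2)) -> L A * L B <= L C ^+ 2.
Proof.
move=> mA mB mC ABC; rewrite -lee_fin expr2 !EFinM -!lamE//.
exact: lam_mid.
Qed.

Let LU (A B : set RT) : measurable A -> measurable B -> L (A `|` B) <= L A + L B.
Proof.
move=> mA mB; rewrite -lee_fin EFinD -!lamE//; last exact: measurableU.
exact: measureU2.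
Qed.

Let mitv (i : interval R) : measurable ([set` i] : set RT).
Proof. exact: measurable_itv. Qed.

Let Phi t := L `]- t, t[%classic / m.

(** The midpoints of the interval and of its mirror image lie in ]-e,e[, and the two have equal mass
    by symmetry. The interval is half-open to allow tilings; its mirror image has the other end
    closed, so the midpoints stay strictly inside. *)
Let L_translate_le (x e : R) : L `[x - e, x + e[%classic <= L `]- e, e[%classic.
Proof.
set A : set RT := `[x - e, x + e[%classic.
have mA : measurable A by exact: mitv.
have mNA : measurable (-%R @^-1` A : set RT).
  by rewrite -[X in measurable X]setTI; exact: oppr_measurable.
have LNA : L (-%R @^-1` A) = L A by rewrite /L lam_sym.
have := L_mid mA mNA (mitv `]- e, e[).
rewrite LNA -expr2 => H.
rewrite -(@ler_pXn2r _ 2)// ?nnegrE//; apply: H => y z.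
by rewrite /A /= !in_itv/= => /andP[? ?] /andP[? ?]; apply/andP; split; lra.
Qed.

Let L_cover (x e : R) (N : nat) : 0 <= e ->
  L `[x, x + N%:R * (2 * e)[%classic <= N%:R * L `]- e, e[%classic.
Proof.
move=> e0; elim: N => [|N ih].
  rewrite !mul0r addr0 set_itv_ge ?bnd_simp ?ltxx//.
  by rewrite /L measure0.
set y := x + N%:R * (2 * e).
have yE : x + N.+1%:R * (2 * e) = y + 2 * e by rewrite /y -[N.+1%:R]natr1; ring.
rewrite yE -[N.+1%:R]natr1 [(_ + 1) * L _]mulrDl mul1r.
have -> : `[x, y + 2 * e[%classic = `[x, y[%classic `|` `[y, y + 2 * e[%classic.
  rewrite -itv_bndbnd_setU// bnd_simp.
    by rewrite lerDl !mulr_ge0.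
  by rewrite lerDl mulr_ge0.
apply: (le_trans (LU (mitv _) (mitv _))); apply: lerD => //.
have -> : `[y, y + 2 * e[%classic = `[(y + e) - e, (y + e) + e[%classic.
  by rewrite addrK -(addrA y e e) -mulr2n mulr_natl.
exact: L_translate_le.
Qed.

(** ]-u,u[ is covered by floor(u / e) + 1 translates of length 2e, each of mass at most that of
    ]-e,e[. Read as Phi(e) / e >= Phi(u) / (u + e), this is concavity of Phi at 0 up to an error
    that vanishes with e. *)
Let Phi_subadd (u e : R) : 0 < u -> 0 < e -> Phi u <= (u / e + 1) * Phi e.
Proof.
move=> u0 e0; rewrite /Phi mulrA ler_pM2r ?invr_gt0//.
pose N := (Num.trunc (u / e)).+1.
have N1 : u / e < N%:R by exact: truncnS_gt.
have N2 : N%:R <= u / e + 1.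
  by rewrite /N -[X in X <= _]natr1 lerD2r truncn_le; apply: divr_ge0; exact: ltW.
apply: (@le_trans _ _ (N%:R * L `]- e, e[%classic)); last by rewrite ler_wpM2r.
apply: le_trans (L_cover (- u) N (ltW e0)).
apply: L_mono; [exact: mitv..|].
move=> x; rewrite /= !in_itv/= => /andP[/ltW -> xu]/=.
apply: (lt_trans xu); have : u < N%:R * e by rewrite -ltr_pdivrMr.
by rewrite [N%:R * (2 * e)]mulrCA; lra.
Qed.

Let PhiE (s : R) : 0 < s -> 1 - Phi s = 2 * L `[s, +oo[%classic / m.
Proof.
move=> s0.
suff H : m = L `]- s, s[%classic + 2 * L `[s, +oo[%classic.
  rewrite /Phi -{1}(divff (lt0r_neq0 m_gt0)) -mulrBl; congr (_ / _).
  by rewrite [X in X - _]H addrAC subrr add0r.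
set B : set RT := `[s, +oo[%classic.
set A : set RT := `]- s, s[%classic.
have mB : measurable B by exact: mitv.
have mA : measurable A by exact: mitv.
have mNB : measurable (-%R @^-1` B : set RT).
  by rewrite -[X in measurable X]setTI; exact: oppr_measurable.
have LNB : L (-%R @^-1` B) = L B by rewrite /L lam_sym.
apply: EFin_inj; rewrite -lamT mulr_natl mulr2n !EFinD -{2}LNB -!lamE//.
rewrite addeCA -measureU//; last first.
  rewrite -subset0 => x [/=]; rewrite /A/B/= !in_itv/= !andbT => /andP[? ?] ?; lra.
rewrite -measureU//; last 2 first.
- exact: measurableU.
- rewrite -subset0 => x [/=]; rewrite /A/B/= !in_itv/= !andbT => ? [/andP[? ?]|?]; lra.
congr (lam _); apply/esym; rewrite -subTset => x _.
rewrite /A/B/= !in_itv/= !andbT.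
have [?|?] := leP s x; first by left.
have [?|?] := leP s (- x); first by right; right.
by right; left; rewrite ltrNl; apply/andP; split.
Qed.

(** Midpoints of [0,+oo[ and [t,+oo[ lie in [t/2,+oo[. By symmetry [0,+oo[ has at least half the
    mass, possibly more because of an atom at 0. *)
Let S_half (t : R) : 0 < t -> 1 - Phi t <= (1 - Phi (t / 2)) ^+ 2.
Proof.
move=> t0; have t20 : 0 < t / 2 by rewrite divr_gt0.
rewrite !PhiE//; set P := L `[t, +oo[%classic; set Q := L `[t / 2, +oo[%classic.
have P0 : m <= 2 * L `[0, +oo[%classic.
  have mNB : measurable (-%R @^-1` (`[0, +oo[%classic : set RT) : set RT).
    by rewrite -[X in measurable X]setTI; exact: oppr_measurable.
  have LNB : L (-%R @^-1` `[0, +oo[%classic) = L `[0, +oo[%classic.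
    by rewrite /L lam_sym.
  rewrite -lee_fin -lamT mulr_natl mulr2n -[X in _ + X]LNB EFinD -!lamE//.
  apply: le_trans (measureU2 _ _ _) => //; apply: measure_mono => //.
    exact: measurableU.
  by move=> x _ /=; rewrite !in_itv/= !andbT oppr_ge0; apply/orP; exact: le_total.
have PQ : L `[0, +oo[%classic * P <= Q ^+ 2.
  apply: L_mid => // x y; rewrite /= !in_itv/= !andbT => x0 ty.
  by rewrite ler_pM2r ?invr_gt0//; lra.
have : m * P <= 2 * Q ^+ 2.
  apply: (@le_trans _ _ (2 * (L `[0, +oo[%classic * P))); last by rewrite ler_wpM2l.
  by rewrite mulrA; apply: ler_wpM2r => //; exact: L_ge0.
move=> H; rewrite expr_div_n ler_pdivrMr//.
have -> : (2 * Q) ^+ 2 / (m ^+ 2) * m = 2 * (2 * Q ^+ 2) / m.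
  by field; rewrite gt_eqF.
rewrite ler_pdivlMr// -mulrA ler_wpM2l// mulrC.
exact: H.
Qed.

Let S_iter (t : R) (k : nat) : 0 < t ->
  1 - Phi t <= (1 - Phi (t / 2 ^+ k)) ^+ (2 ^ k).
Proof.
move=> t0; elim: k => [|k ih]; first by rewrite expr0 divr1 expr1.
apply: (le_trans ih); rewrite expnS exprM; apply: lerXn2r.
- by rewrite nnegrE PhiE ?divr_gt0 ?exprn_gt0// !mulr_ge0// invr_ge0 ltW.
- by rewrite nnegrE sqr_ge0.
- have -> : t / 2 ^+ k.+1 = t / 2 ^+ k / 2 by rewrite exprSr invfM mulrA.
  by apply: S_half; rewrite divr_gt0 ?exprn_gt0.
Qed.

(** With e = t / 2^k, the iterated halving gives 1 - Phi(t) <= (1 - Phi(e))^(2^k) <= exp(- (t / e)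
    Phi(e)). [Phi_subadd] bounds Phi(e) / e below by Phi(u) / (u + e), and k tends to infinity. *)
Lemma logconcave_tail (t u : R) : 0 < t -> 0 < u ->
  1 - Phi t <= expR (- (Phi u / u) * t).
Proof.
move=> t0 u0.
have bound k : 1 - Phi t <= expR (- (Phi u / (u + t / 2 ^+ k)) * t).
  set e := t / 2 ^+ k.
  have e0 : 0 < e by rewrite divr_gt0 ?exprn_gt0.
  have ue0 : 0 < u + e by rewrite addr_gt0.
  have S0 : 0 <= 1 - Phi e.
    by rewrite PhiE// !mulr_ge0// invr_ge0 ltW.
  apply: (le_trans (S_iter k t0)); rewrite -/e.
  apply: (@le_trans _ _ (expR (- Phi e) ^+ (2 ^ k))).
    by apply: lerXn2r; rewrite ?nnegrE ?expR_ge0// expR_ge1Dx.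
  rewrite -expRM_natl ler_expR mulNr mulrN lerN2.
  have kE : (2 ^ k)%:R = t / e :> R.
    by rewrite natrX /e invfM invrK mulrA divff ?mul1r// gt_eqF.
  rewrite kE mulrAC ler_pdivrMr//.
  have := Phi_subadd u0 e0.
  have -> : u / e + 1 = (u + e) / e by rewrite mulrDl divff// gt_eqF.
  move=> H; rewrite -(ler_pM2l t0) in H.
  apply: (le_trans (_ : _ <= t * ((u + e) / e * Phi e))).
    by rewrite mulrC.
  by rewrite le_eqVlt; apply/orP; left; apply/eqP; field; rewrite !gt_eqF.
have cv : expR (- (Phi u / (u + t / 2 ^+ k)) * t) @[k --> \oo] -->
    expR (- (Phi u / u) * t).
  apply: continuous_cvg; first exact: continuous_expR.
  apply: cvgMl; apply: cvgN; apply: cvgMr; apply: cvgV; first by rewrite gt_eqF.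
  rewrite -[X in _ --> X]addr0; apply: cvgD; first exact: cvg_cst.
  rewrite -(mulr0 t); apply: cvgMr.
  under eq_fun do rewrite -exprVn.
  by apply: cvg_expr; rewrite ger0_norm// invf_lt1// ltr1n.
rewrite -(cvg_lim _ cv)//; apply: limr_ge; last exact: nearW.
by apply/cvg_ex; eexists; exact: cv.
Qed.

Lemma logconcave_measure_ge (t u : R) : 0 < t -> 0 < u ->
  ((m * (1 - expR (- (fine (lam `](- u)%R, u[%classic) / (m * u)) * t)))%:E <=
   lam `](- t)%R, t[%classic)%E.
Proof.
move=> t0 u0; rewrite (lamE (mitv `](- t), t[)) lee_fin mulrC -ler_pdivlMr//.
have := logconcave_tail t0 u0.
by rewrite /Phi /L invfM mulrA; lra.
Qed.

End symmetric_logconcave.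

(** * Comparison of moments *)

Section moment_comparison.
Local Open Scope ereal_scope.
Context {R : realType}.
Local Notation RT := (measurableTypeR R).
Local Notation mu := (@lebesgue_measure R).

(** With chi the indicator of ]0,T], both phi - m chi and r^(q-p) - T^(q-p) are non-positive up to T
    and non-negative beyond, so their product is non-negative. Multiplied by r^(p-1) and integrated,
    it bounds the excess of the q-th moment over m T^q / q below by T^(q-p) times the excess of the
    p-th. *)
Lemma bounded_moment_mono (phi : R -> R) (m p q T : R) :
  measurable_fun [set: R] phi -> (forall r, 0 <= phi r <= m)%R ->
  (0 < p)%R -> (p <= q)%R -> (0 < T)%R ->
  (m * T `^ p / p)%:E <= \int[mu]_(r in `]0%R, +oo[) (phi r * r `^ (p - 1))%:E ->
  (m * T `^ q / q)%:E <= \int[mu]_(r in `]0%R, +oo[) (phi r * r `^ (q - 1))%:E.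
Proof.
move=> mphi phi01 p0 pq T0 H; have q0 := lt_le_trans p0 pq.
have phi0 r : (0 <= phi r)%R by case/andP: (phi01 r).
have phim r : (phi r <= m)%R by case/andP: (phi01 r).
have m0 : (0 <= m)%R := le_trans (phi0 0%R) (phim 0%R).
pose chi (r : R) : R := \1_(`]0%R, T]%classic : set RT) r.
have chi0 r : (0 <= chi r)%R by [].
have mchi : measurable_fun [set: RT] chi by exact: measurable_indic.
have mpow (s : R) : measurable_fun [set: RT] (fun r : RT => r `^ s)%R.
  exact: measurable_powR.
have mphip (s : R) : measurable_fun [set: RT] (fun r : RT => phi r * r `^ s)%R.
  exact: measurable_funM.
have phip0 (s r : R) : (0 <= phi r * r `^ s)%R by rewrite mulr_ge0// powR_ge0.
have mchip (s : R) : measurable_fun [set: RT] (fun r : RT => chi r * r `^ s)%R.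
  exact: measurable_funM.
have chip0 (s r : R) : (0 <= chi r * r `^ s)%R by rewrite mulr_ge0// powR_ge0.
have Ichi (s : R) : (0 < s)%R ->
    \int[mu]_(r in `]0%R, +oo[) (chi r * r `^ (s - 1))%:E = (T `^ s / s)%:E.
  move=> s0; rewrite -(integral_powR s0 (ltW T0)).
  rewrite [LHS]integral_in_indic [RHS]integral_in_indic; apply: eq_integral => r _.
  rewrite EFinM muleA; congr (_ * _); rewrite -EFinM; congr EFin.
  rewrite /chi !indicE !mem_setE !in_itv/= andbT.
  by case: ltP => _ /=; rewrite ?mul1r ?mul0r.
set c := (T `^ (q - p))%R; have c0 : (0 <= c)%R by exact: powR_ge0.
(* The terms are distributed so that both sides are sums of non-negative ones, as the moments of
   [phi] may be infinite. *)
have key r : (0 < r)%R ->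
    (c * (phi r * r `^ (p - 1)) + m * (chi r * r `^ (q - 1)) <=
     phi r * r `^ (q - 1) + m * c * (chi r * r `^ (p - 1)))%R.
  move=> r0.
  have -> : (r `^ (q - 1) = r `^ (q - p) * r `^ (p - 1))%R.
    rewrite -powRD; last by apply/implyP => _; rewrite gt_eqF.
    by congr (_ `^ _)%R; ring.
  set d := (r `^ (q - p))%R; set w := (r `^ (p - 1))%R.
  have w0 : (0 <= w)%R by exact: powR_ge0.
  suff : (0 <= (phi r - m * chi r) * (d - c) * w)%R by lra.
  rewrite mulr_ge0//; rewrite /chi indicE mem_setE in_itv/= r0/=.
  have qp0 : (0 <= q - p)%R by rewrite subr_ge0.
  have [rT|Tr] := leP r T; rewrite ?mulr1 ?mulr0 ?subr0.
    rewrite mulr_le0// subr_le0//.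
    by apply: ge0_ler_powR => //; rewrite nnegrE ltW.
  rewrite mulr_ge0// subr_ge0.
  by apply: ge0_ler_powR => //; rewrite ?nnegrE ltW.
have mcphi : measurable_fun [set: RT] (fun r : RT => c * (phi r * r `^ (p - 1)))%R.
  by apply: measurable_funM => //; exact: measurable_cst.
have mmchi (d s : R) : measurable_fun [set: RT] (fun r : RT => d * (chi r * r `^ s))%R.
  by apply: measurable_funM => //; exact: measurable_cst.
have mc0 : (0 <= m * c)%R by exact: mulr_ge0.
have cphi0 r : (0 <= c * (phi r * r `^ (p - 1)))%R by exact: mulr_ge0.
have mchip0 r : (0 <= m * (chi r * r `^ (q - 1)))%R by exact: mulr_ge0.
have mcchip0 r : (0 <= m * c * (chi r * r `^ (p - 1)))%R by exact: mulr_ge0.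
have := @ge0_le_integral _ _ _ mu (`]0%R, +oo[%classic : set RT) (measurable_itv _)
  (fun r => (c * (phi r * r `^ (p - 1)) + m * (chi r * r `^ (q - 1)))%:E)
  (fun r => (phi r * r `^ (q - 1) + m * c * (chi r * r `^ (p - 1)))%:E).
rewrite (ge0_integral_itv0yD mcphi (mmchi _ _) cphi0 mchip0).
rewrite (ge0_integral_itv0yD (mphip _) (mmchi _ _) (phip0 _) mcchip0).
rewrite (ge0_integral_itv0yZ c0 (mphip _) (phip0 _)).
rewrite (ge0_integral_itv0yZ m0 (mchip _) (chip0 _)).
rewrite (ge0_integral_itv0yZ mc0 (mchip _) (chip0 _)).
rewrite !Ichi// => /(_ _ _ _ _) le_int.
have {}le_int : (c * (m * T `^ p / p))%:E + (m * (T `^ q / q))%:E <=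
    \int[mu]_(r in `]0%R, +oo[) (phi r * r `^ (q - 1))%:E + (m * c * (T `^ p / p))%:E.
  apply: (le_trans _ (le_int _ _ _ _)).
  - by rewrite leeD2r// EFinM lee_wpmul2l.
  - by move=> r _; rewrite lee_fin addr_ge0.
  - by apply/measurable_EFinP/measurable_funTS; exact: measurable_funD.
  - by apply/measurable_EFinP/measurable_funTS; exact: measurable_funD.
  - by move=> r; rewrite /= in_itv/= andbT => r0; rewrite lee_fin key.
have cE : (c * (m * T `^ p / p) = m * c * (T `^ p / p))%R by ring.
rewrite addeC cE in le_int.
by move: le_int; rewrite leeD2lE// mulrA.
Qed.

Lemma spectral_moment_reverse (lam : {finite_measure set RT -> \bar R}) (m p T : R)
    (phi : R -> R) : (0 < m)%R -> lam setT = m%:E -> (forall r, 0 <= phi r)%R ->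
  (forall r, \int[lam]_z (1 + cos (z * r))%:E = (m + phi r)%:E) ->
  (forall A B C : set RT, measurable A -> measurable B -> measurable C ->
    (forall x y, A x -> B y -> C ((x + y) / 2)%R) ->
    lam A * lam B <= lam C * lam C) ->
  (forall A : set RT, measurable A -> lam (-%R @^-1` A) = lam A) ->
  (0 < p < 1)%R -> (0 <= T)%R ->
  (m * T)%:E <= \int[mu]_(r in `]0%R, +oo[) (phi r)%:E ->
  (m * (2 / pi * T) `^ p / p)%:E <=
    \int[mu]_(r in `]0%R, +oo[) (phi r * r `^ (p - 1))%:E.
Proof.
move=> m0 lamT phi0 phiE lam_mid lam_sym p01 T0 mT.
have /andP[p0 p1] := p01; have m0' := ltW m0.
set I := (X in _ <= X).
have I0 : 0 <= I.
  by apply: integral_ge0 => r _; rewrite lee_fin mulr_ge0// powR_ge0.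
have [->|IJ] := eqVneq I +oo; first by rewrite leey.
have {}IJ : I \is a fin_num by rewrite ge0_fin_numE// ltey.
rewrite -(fineK IJ) lee_fin; set J := fine I.
have J0 : (0 <= J)%R by exact: fine_ge0.
(* The solution of m A^p / p = J. The moment bound for the exponential law then says that no rate
   exceeds [A]. *)
pose A := ((p * J / m) `^ p^-1)%R.
have A0 : (0 <= A)%R by exact: powR_ge0.
have Ap : (A `^ p = p * J / m)%R.
  by rewrite -powRrM mulVf ?gt_eqF// powRr1// divr_ge0// mulr_ge0// ltW.
have below_A a : (0 <= a)%R -> (m * (a `^ p / p) <= J)%R -> (a <= A)%R.
  move=> a0 H; rewrite leNgt; apply/negP => Aa.
  have : (A `^ p < a `^ p)%R by apply: gt0_ltr_powR => //; rewrite nnegrE.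
  rewrite Ap ltNge => /negP; apply.
  by rewrite ler_pdivlMr// [(p * J)%R]mulrC -ler_pdivrMr// mulrAC mulrC.
have lamA u : (0 < u)%R -> lam `](- u)%R, u[%classic <= (m * A * u)%:E.
  move=> u0; set L := lam _.
  have mI : measurable (`](- u)%R, u[%classic : set RT) by exact: measurable_itv.
  have Lfin : L \is a fin_num by exact: (fin_num_measure lam _ mI).
  have L0 : (0 <= fine L)%R by apply: fine_ge0; exact: measure_ge0.
  pose a := (fine L / (m * u))%R.
  have a0 : (0 <= a)%R by rewrite divr_ge0// mulr_ge0// ltW.
  suff aA : (a <= A)%R.
    by rewrite -(fineK Lfin) lee_fin mulrAC mulrC -ler_pdivrMr// mulr_gt0.
  (* At rate 0 there is no exponential law to compare with, but the bound is trivial. *)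
  have [->//|an0] := eqVneq a 0%R.
  have a_gt0 : (0 < a)%R by rewrite lt_neqAle eq_sym an0.
  apply: below_A => //; rewrite -lee_fin /J fineK//.
  apply: (spectral_moment_ge m0 lamT phi0 phiE a_gt0 p01) => t t0.
  exact: (logconcave_measure_ge m0 lamT lam_mid lam_sym t0 u0).
have := le_trans mT (spectral_integral_le m0 lamT phi0 phiE A0 lamA).
rewrite lee_fin -mulrA ler_pM2l// => TA.
have TA' : (2 / pi * T <= A)%R.
  rewrite mulrAC ler_pdivrMr ?pi_gt0// mulrC -ler_pdivlMr//.
  by rewrite -mulrA.
have : ((2 / pi * T) `^ p <= A `^ p)%R.
  apply: ge0_ler_powR => //; first exact: ltW.
  by rewrite nnegrE mulr_ge0// divr_ge0// pi_ge0.
rewrite Ap ler_pdivlMr// => H.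
by rewrite ler_pdivrMr// [(J * p)%R]mulrC [(m * _)%R]mulrC.
Qed.

End moment_comparison.

(** * The law of a difference *)

Section restricted_law.
Local Open Scope ereal_scope.
Context {R : realType}.
Local Notation RT := (measurableTypeR R).

Lemma restricted_law d (T : measurableType d) (mu : {measure set T -> \bar R})
    (D : set T) (Z : T -> RT) : measurable D -> mu D < +oo ->
  measurable_fun setT Z ->
  exists lam : {finite_measure set RT -> \bar R},
    (forall A, measurable A -> lam A = mu (D `&` Z @^-1` A)) /\
    (forall f : RT -> \bar R, measurable_fun setT f -> (forall z, 0 <= f z) ->
      \int[lam]_z f z = \int[mu]_(x in D) f (Z x)).
Proof.
move=> mD muD mZ.
pose restr : {measure set T -> \bar R} := mrestr mu mD.
pose nu0 : {measure set RT -> \bar R} := pushforward restr Z.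
pose nu : {measure set RT -> \bar R} := nu0 mZ.
have nuT : nu setT < +oo.
  by rewrite /nu/= /pushforward /restr/= /mrestr preimage_setT setTI.
(* Restricting to the whole line changes no value; it supplies the structure of a finite measure. *)
pose lam : {finite_measure set RT -> \bar R} := mfrestr measurableT nuT.
have lamE A : measurable A -> lam A = mu (D `&` Z @^-1` A).
  move=> mA; rewrite /lam/= /mfrestr /mrestr setIT /nu/= /pushforward/= /mrestr.
  by rewrite setIC.
exists lam; split => // f mf f0.
transitivity (\int[nu]_z f z).
  by apply: eq_measure_integral => A mA _; rewrite /lam/= /mfrestr /mrestr setIT.
rewrite (ge0_integral_pushforward mZ restr measurableT mf) ?preimage_setT//.
rewrite (@ge0_negligible_integral _ _ _ restr setT (~` D))//; last 4 first.
- exact: measurableC.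
- exact: measurableT_comp.
- by move=> x _; exact: f0.
- by rewrite /restr/= /mrestr setICl measure0.
rewrite setDE setCK setTI.
by apply: eq_measure_integral => A mA AD; rewrite /restr/= /mrestr (setIidl AD).
Qed.

End restricted_law.

Section difference_law.
Local Open Scope ereal_scope.
Context {R : realType}.
Local Notation RT := (measurableTypeR R).
Variables (n : nat) (K : set 'rV[R]_n) (theta : 'rV[R]_n).
Hypothesis Kbody : convex_body K.
Local Notation leb := (@lebesgue_rV R n).
Local Notation T := ('rV[R]_n).

Let mK : measurable K. Proof. exact: convex_body_measurable. Qed.
Let volE : leb K = (vol K)%:E. Proof. by have [] := convex_body_vol Kbody. Qed.

Let mdot : measurable_fun [set: T] (fun x => dotv x theta).
Proof.
rewrite /dotv; apply: measurable_sum => i.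
by apply: measurable_funM; [exact: measurable_rV_coord|exact: measurable_cst].
Qed.

Let Z (p : T * T) : RT := (dotv p.1 theta - dotv p.2 theta)%R.

Let mZ : measurable_fun [set: T * T] Z.
Proof.
apply: measurable_funB.
- exact: (measurableT_comp mdot measurable_fst).
- exact: (measurableT_comp mdot measurable_snd).
Qed.

Let KK : set (T * T) := K `*` K.

Let mKK : measurable KK. Proof. exact: measurableX. Qed.

Let muKK : (leb \x leb) KK = (vol K ^+ 2)%:E.
Proof.
transitivity (leb K * leb K); first exact: product_measure1E.
by rewrite volE -EFinM expr2.
Qed.

Lemma dotv_mid (x y : T) :
  dotv (2^-1 *: (x + y))%R theta = ((dotv x theta + dotv y theta) / 2)%R.
Proof.
rewrite /dotv -big_split mulr_suml; apply: eq_bigr => i _ /=.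
by rewrite !mxE; ring.
Qed.

Lemma convex_body_mid (x y : T) : K x -> K y -> K (2^-1 *: (x + y))%R.
Proof.
move=> Kx Ky; have [_ cK _] := Kbody.
have h0 : (0 <= 2^-1 :> R)%R by [].
have h1 : (2^-1 <= 1 :> R)%R by rewrite invf_le1// ler1n.
have := cK x y (Itv01 h0 h1) (mem_set Kx) (mem_set Ky); rewrite inE => Kxy.
have -> : (2^-1 *: (x + y) = 2^-1 *: x + (1 - 2^-1) *: y)%R.
  by rewrite scalerDr; congr (_ + _ *: _)%R; field.
exact: Kxy.
Qed.

(** Exchanging the two points changes the sign of [Z], which makes its law symmetric. *)
Lemma product_measure_swap (B : set (T * T)) : measurable B ->
  (leb \x leb) ((fun p => (p.2, p.1)) @^-1` B) = (leb \x leb) B.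
Proof.
move=> mB.
pose sw (p : T * T) : T * T := (p.2, p.1).
have msw : measurable_fun setT sw by exact: measurable_fun_pair.
pose nu0 : {measure set (T * T) -> \bar R} := pushforward (leb \x leb) sw.
pose nu : {measure set (T * T) -> \bar R} := nu0 msw.
apply/esym; rewrite -[RHS]/(nu B); apply: product_measure_unique => // A1 A2 mA1 mA2.
rewrite /nu/= /pushforward.
rewrite (_ : _ @^-1` _ = A2 `*` A1).
  by rewrite product_measure1E// muleC.
by apply/seteqP; split => p [].
Qed.

(** The midpoint inequality is Prékopa-Leindler on R^n x R^n for the indicators of the sets [KK] ∩
    Z^(-1)(A), and likewise for B and C: [KK] contains its midpoints and [Z] commutes with them. *)
Lemma difference_law_exists : exists lam : {finite_measure set RT -> \bar R},
  [/\ lam setT = (vol K ^+ 2)%:E,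
  (forall A B C : set RT, measurable A -> measurable B -> measurable C ->
    (forall x y, A x -> B y -> C ((x + y) / 2)%R) ->
    lam A * lam B <= lam C * lam C),
  (forall A : set RT, measurable A -> lam (-%R @^-1` A) = lam A) &
  (forall f : RT -> \bar R, measurable_fun setT f -> (forall z, 0 <= f z) ->
      \int[lam]_z f z = \int[leb \x leb]_(p in KK) f (Z p))].
Proof.
have [lam [lamE lamI]] : exists lam : {finite_measure set RT -> \bar R},
    (forall A, measurable A -> lam A = (leb \x leb) (KK `&` Z @^-1` A)) /\
    (forall f : RT -> \bar R, measurable_fun setT f -> (forall z, 0 <= f z) ->
      \int[lam]_z f z = \int[leb \x leb]_(p in KK) f (Z p)).
  by apply: restricted_law => //; rewrite [X in X < _]muKK ltry.
have mE A : measurable A -> measurable (KK `&` Z @^-1` A).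
  by move=> mA; apply: measurableI => //; rewrite -[X in measurable X]setTI; exact: mZ.
exists lam; split => //.
- by rewrite lamE// preimage_setT setIT muKK.
- move=> A B C mA mB mC ABC; rewrite !lamE//.
  have := prekopa_leindler_prod (@prekopa_leindler_rV R n) (@prekopa_leindler_rV R n).
  have mI D : measurable D -> measurable_fun setT (fun p : T * T =>
      (\1_(KK `&` Z @^-1` D) p)%:E : \bar R).
    by move=> mD; apply/measurable_EFinP; apply: measurable_indic; exact: mE.
  move=> /(_ _ _ _ (mI A mA) (mI B mB) (mI C mC)).
  have EI D : measurable D -> \int[leb \x leb]_p (\1_(KK `&` Z @^-1` D) p)%:E =
      (leb \x leb) (KK `&` Z @^-1` D).
    by move=> mD; rewrite integral_indic ?setIT//; exact: mE.
  have ind0 D p : ~ (KK `&` Z @^-1` D) p ->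
      \1_(KK `&` Z @^-1` D) p = 0%R :> R.
    by move=> nD; rewrite indicE memNset.
  rewrite !EI//; apply=> [p|p|p|p q]; rewrite /= ?lee_fin//.
  have [[[Kp1 Kp2] Ap]|nA] := pselect ((KK `&` Z @^-1` A) p); last first.
    by rewrite (ind0 _ _ nA) mul0r mulr_ge0.
  have [[[Kq1 Kq2] Bq]|nB] := pselect ((KK `&` Z @^-1` B) q); last first.
    by rewrite (ind0 _ _ nB) mulr0 mulr_ge0.
  rewrite !indicE !mem_set//.
  split; first by split; exact: convex_body_mid.
  rewrite /= /Z/= !dotv_mid.
  have := ABC _ _ Ap Bq; rewrite /Z; congr C.
  by ring.
- move=> A mA; rewrite !lamE//; last first.
    by rewrite -[X in measurable X]setTI; exact: oppr_measurable.
  rewrite -[RHS]product_measure_swap; last exact: mE.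
  congr (_ _); apply/seteqP; split => p /=; rewrite /KK/Z/= => -[[? ?]];
    by rewrite opprB.
Qed.

Let C (r : R) : R := fine (\int[leb]_(x in K) (cos (dotv x theta * r))%:E).
Let S (r : R) : R := fine (\int[leb]_(x in K) (sin (dotv x theta * r))%:E).

Let mcos (r : R) : measurable_fun [set: T] (fun x => cos (dotv x theta * r)).
Proof.
apply: measurableT_comp; first exact: (continuous_measurable_fun (@continuous_cos R)).
exact: measurable_funM.
Qed.

Let msin (r : R) : measurable_fun [set: T] (fun x => sin (dotv x theta * r)).
Proof.
apply: measurableT_comp; first exact: (continuous_measurable_fun (@continuous_sin R)).
exact: measurable_funM.
Qed.

Let bounded_integrable (g : T -> R) : measurable_fun [set: T] g ->
  (forall x, `|g x| <= 1)%R -> leb.-integrable K (EFin \o g).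
Proof.
move=> mg g1; apply: measurable_bounded_integrable => //.
- by rewrite [X in X < _]volE ltry.
- exact: measurable_funTS.
- exists 1%R; split => // M M1 x _; exact: le_trans (g1 x) (ltW M1).
Qed.

Let icos (r : R) : leb.-integrable K (fun x => (cos (dotv x theta * r))%:E).
Proof.
by apply: bounded_integrable => // x; rewrite ler_norml cos_geN1 cos_le1.
Qed.

Let isin (r : R) : leb.-integrable K (fun x => (sin (dotv x theta * r))%:E).
Proof.
by apply: bounded_integrable => // x; rewrite ler_norml sin_geN1 sin_le1.
Qed.

Let integral_affine (a b c r : R) :
  \int[leb]_(x in K) (a + b * cos (dotv x theta * r) + c * sin (dotv x theta * r))%:E =
  (a * vol K + b * C r + c * S r)%:E.
Proof.
have ia : leb.-integrable K (fun=> a%:E).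
  apply: measurable_bounded_integrable => //.
    by rewrite [X in X < _]volE ltry.
  by exists `|a|%R; split => // M aM x _; exact: ltW.
have ib : leb.-integrable K (fun x => b%:E * (cos (dotv x theta * r))%:E).
  exact: integrableZl.
have ic : leb.-integrable K (fun x => c%:E * (sin (dotv x theta * r))%:E).
  exact: integrableZl.
transitivity (\int[leb]_(x in K)
    ((a%:E + b%:E * (cos (dotv x theta * r))%:E) + c%:E * (sin (dotv x theta * r))%:E)).
  by apply: eq_integral.
rewrite integralD//; last exact: integrableD.
rewrite integralD// integral_cst// !integralZl//.
rewrite !EFinD !EFinM; congr (_ * _ + _ * _ + _ * _).
- exact: volE.
- by rewrite /C fineK// integrable_fin_num.
- by rewrite /S fineK// integrable_fin_num.
Qed.

Lemma fourier_indic_normE (r : R) :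
  (Normc.normc (fourier (fun x : T => (\1_K x)%:C) (r *: theta)) ^+ 2 =
   C r ^+ 2 + S r ^+ 2)%R.
Proof.
rewrite /fourier /cintegral /= sqr_sqrtr ?addr_ge0 ?sqr_ge0//.
have dotE x : dotv x (r *: theta) = (dotv x theta * r)%R.
  by rewrite /dotv mulr_suml; apply: eq_bigr => i _; rewrite mxE; ring.
congr (_ ^+ 2 + _)%R.
  rewrite /Rintegral /C; congr fine.
  rewrite [RHS]integral_in_indic; apply: eq_integral => x _.
  by rewrite dotE cosN mulr0 subr0 -EFinM mulrC.
rewrite /Rintegral.
(* The sign in the Fourier exponent affects only the imaginary part and disappears in the square. *)
transitivity ((- S r) ^+ 2)%R; last by rewrite sqrrN.
congr (_ ^+ 2)%R.
transitivity (fine (\int[leb]_(x in K) ((-1)%:E * (sin (dotv x theta * r))%:E))).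
  congr fine; rewrite [RHS]integral_in_indic; apply: eq_integral => x _.
  by rewrite dotE sinN mulr0 add0r -!EFinM mulN1r mulrC.
by rewrite integralZl// fineM ?integrable_fin_num// mulN1r.
Qed.

(** By the addition formula the inner integral is affine in the cosine and sine of <x,theta> r with
    coefficients [C r] and [S r]; the outer one squares them. *)
Lemma difference_law_cos (r : R) :
  \int[leb \x leb]_(p in KK) (1 + cos (Z p * r))%:E =
  (vol K ^+ 2 +
   Normc.normc (fourier (fun x : T => (\1_K x)%:C) (r *: theta)) ^+ 2)%:E.
Proof.
rewrite fourier_indic_normE integral_in_indic.
have cos1_ge0 (t : R) : (0 <= 1 + cos t)%R by rewrite -lerBlDl sub0r cos_geN1.
rewrite fubini_tonelli1; last 2 first.
- apply: emeasurable_funM; apply/measurable_EFinP; first exact: measurable_indic.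
  apply: measurable_funD => //; apply: measurableT_comp.
    exact: (continuous_measurable_fun (@continuous_cos R)).
  exact: measurable_funM.
- by move=> p; rewrite mule_ge0// lee_fin.
transitivity (\int[leb]_(x in K) (vol K + C r * cos (dotv x theta * r) +
    S r * sin (dotv x theta * r))%:E); last first.
  by rewrite integral_affine; congr EFin; ring.
rewrite [RHS]integral_in_indic; apply: eq_integral => x _.
transitivity (\int[leb]_y ((\1_K x)%:E * ((\1_K y)%:E *
    (1 + cos (dotv x theta * r) * cos (dotv y theta * r) +
     sin (dotv x theta * r) * sin (dotv y theta * r))%:E))).
  apply: eq_integral => y _; rewrite /Z/= mulrBl cosB addrA muleA; congr (_ * _).
  rewrite -EFinM; congr EFin; rewrite !indicE /KK in_setX/=.
  by case: (x \in K); case: (y \in K); rewrite /= ?mulr1 ?mulr0.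
rewrite [\1_K x]indicE; case: (x \in K); last first.
  rewrite mul0e; under eq_integral do rewrite mul0e.
  exact: integral0.
under eq_integral do rewrite mul1e.
rewrite -integral_in_indic integral_affine mul1e; congr EFin.
by rewrite mul1r [(cos _ * _)%R]mulrC [(sin _ * _)%R]mulrC.
Qed.

Theorem fourier_spectral_law : exists lam : {finite_measure set RT -> \bar R},
  [/\ lam setT = (vol K ^+ 2)%:E,
  (forall A B C : set RT, measurable A -> measurable B -> measurable C ->
    (forall x y, A x -> B y -> C ((x + y) / 2)%R) ->
    lam A * lam B <= lam C * lam C),
  (forall A : set RT, measurable A -> lam (-%R @^-1` A) = lam A) &
  (forall r : R, \int[lam]_z (1 + cos (z * r))%:E = (vol K ^+ 2 +
    Normc.normc (fourier (fun x : T => (\1_K x)%:C) (r *: theta)) ^+ 2)%:E)].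
Proof.
have [lam [lamT lam_mid lam_sym lamI]] := difference_law_exists.
exists lam; split => // r; rewrite lamI ?difference_law_cos//.
apply/measurable_EFinP; apply: measurable_funD => //; apply: measurableT_comp.
  exact: (continuous_measurable_fun (@continuous_cos R)).
exact: measurable_funM.
Qed.

End difference_law.

(** * Radial functions as moment inequalities, and the two inclusions *)

Lemma fourier_mean_radial_ge (R : realType) n (p : R) (K : set 'rV[R]_n)
    (theta : 'rV[R]_n) (t : R) : 0 < p -> 0 < vol K -> 0 <= t ->
  ((t%:E <= fourier_mean_radial p K theta) =
   ((vol K ^+ 2 * (t * vol K `^ (- p^-1)) `^ p / p)%:E <=
    \int[@lebesgue_measure R]_(r in `]0%R, +oo[)
      ((Normc.normc (fourier (fun x => (\1_K x)%:C) (r *: theta)) ^+ 2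
        * r `^ (p - 1))%R)%:E))%E.
Proof.
move=> p0 V0 t0; rewrite /fourier_mean_radial; set I := integral _ _ _.
have I0 : (0 <= I)%E.
  by apply: integral_ge0 => r _; rewrite lee_fin mulr_ge0 ?sqr_ge0 ?powR_ge0.
set V := vol K in V0 *.
have pn0 : p != 0 by rewrite gt_eqF.
have Vn0 : V != 0 by rewrite gt_eqF.
(* Since V^2 (V^(-1/p))^p = V, the claimed bound is that on t^p multiplied by V / p. *)
have -> : V ^+ 2 * (t * V `^ (- p^-1)) `^ p / p = V / p * t `^ p.
  rewrite powRM ?powR_ge0// -powRrM mulNr mulVf// powRN powRr1 ?ltW//.
  by field; rewrite Vn0 pn0.
have X0 : (0 <= (p / V)%:E * I)%E by rewrite mule_ge0// lee_fin divr_ge0 ?ltW.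
have IE : I = ((V / p)%:E * ((p / V)%:E * I))%E.
  rewrite muleA -EFinM (_ : V / p * (p / V) = 1) ?mul1e//.
  by field; rewrite Vn0 pn0.
rewrite [X in _ = (_ <= X)%E]IE [(V / p * _)%:E]EFinM.
rewrite [RHS]lee_pmul2l//; last by rewrite lte_fin divr_gt0.
move: X0; move: ((p / V)%:E * I)%E => X X0.
have pi_ge0' : 0 <= p^-1 by rewrite invr_ge0 ltW.
have le_pow (s : R) (x y : \bar R) : 0 <= s -> (0 <= x)%E -> (x <= y)%E ->
    (x `^ s <= y `^ s)%E.
  move=> s0 x0 xy; apply: gt0_ler_poweR => //; rewrite in_itv/= leey andbT//.
  exact: le_trans xy.
apply/idP/idP => H.
- have := le_pow _ _ _ (ltW p0) _ H; rewrite lee_fin => /(_ t0).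
  by rewrite -poweRrM mulVf// poweRe1// poweR_EFin.
- have := le_pow _ _ _ pi_ge0' _ H; rewrite lee_fin => /(_ (powR_ge0 _ _)).
  by rewrite poweR_EFin -powRrM mulfV// powRr1.
Qed.

Theorem proposition14 (R : realType) (n : nat) (n_gt0 : (0 < n)%N) (p q : R)
    (p_gt0 : 0 < p) (ltpq : p < q) (q_le1 : q <= 1)
    (K : set 'rV[R]_n) (Kbody : convex_body K) :
  [set 2 / pi * vol K `^ (p^-1 - q^-1) *: x | x in fourier_mean_body q K]
    `<=` fourier_mean_body p K /\
  fourier_mean_body p K `<=`
    [set vol K `^ (p^-1 - q^-1) *: x | x in fourier_mean_body q K].
Proof.
have q_gt0 : 0 < q := lt_trans p_gt0 ltpq.
have p01 : 0 < p < 1 by rewrite p_gt0 (lt_le_trans ltpq).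
have [_ V0] := convex_body_vol Kbody.
have m0 : 0 < vol K ^+ 2 by rewrite exprn_gt0.
pose phi theta r : R :=
  Normc.normc (fourier (fun x => (\1_K x)%:C) (r *: theta)) ^+ 2.
have phi0 theta r : 0 <= phi theta r by exact: sqr_ge0.
have phi_bounded theta : measurable_fun [set: R] (phi theta) /\
    forall r, 0 <= phi theta r <= vol K ^+ 2.
  have [lam [lamT _ _ phiE]] := fourier_spectral_law theta Kbody.
  split; first exact: (measurable_spectral phiE).
  by move=> r; rewrite phi0 (spectral_le lamT phiE).
have powV a b : vol K `^ a * vol K `^ b = vol K `^ (a + b).
  by rewrite -powRD//; apply/implyP => _; rewrite gt_eqF.
split.
(* [bounded_moment_mono] raises the exponent from [q] to 1, where [q_le1] enters;
   [spectral_moment_reverse] then descends from 1 to [p] at the cost of 2 / pi. *)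
- move=> _ [_ [theta [t [theta1 t0 tq ->]]] <-].
  have t'0 : 0 <= 2 / pi * vol K `^ (p^-1 - q^-1) * t.
    by rewrite !mulr_ge0 ?powR_ge0 ?invr_ge0 ?pi_ge0.
  exists theta, (2 / pi * vol K `^ (p^-1 - q^-1) * t); split => //.
    rewrite fourier_mean_radial_ge//.
    move: tq; rewrite fourier_mean_radial_ge//; set T := t * vol K `^ (- q^-1) => Tq.
    have -> : 2 / pi * vol K `^ (p^-1 - q^-1) * t * vol K `^ (- p^-1) = 2 / pi * T.
      rewrite -!mulrA; congr (_ * (_ * _)); rewrite mulrCA powV /T.
      by congr (_ * _ `^ _); ring.
    have [lam [lamT lam_mid lam_sym phiE]] := fourier_spectral_law theta Kbody.
    have [mphi phi_bound] := phi_bounded theta.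
    (* [bounded_moment_mono] requires T > 0; here T >= 0, and for T = 0 the claimed lower bound is
       0. *)
    have [T0|T0] := leP T 0.
      rewrite (_ : T = 0) ?mulr0 ?powR0 ?gt_eqF// ?mulr0 ?mul0r.
        by apply: integral_ge0 => r _; rewrite lee_fin mulr_ge0 ?powR_ge0 ?phi0.
      by apply/eqP; rewrite eq_le T0 mulr_ge0// powR_ge0.
    apply: (spectral_moment_reverse m0 lamT (phi0 theta) phiE lam_mid lam_sym p01 (ltW T0)).
    have := bounded_moment_mono mphi phi_bound q_gt0 q_le1 T0 Tq.
    rewrite invr1 mulr1 powRr1 ?(ltW T0)//; congr (_ <= _)%E.
    by apply: eq_integral => r _; rewrite subrr powRr0 mulr1.
  by rewrite scalerA.
- move=> _ [theta [t [theta1 t0 tp ->]]].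
  have c0 : 0 < vol K `^ (p^-1 - q^-1) by rewrite powR_gt0.
  have t'0 : 0 <= t / vol K `^ (p^-1 - q^-1) by rewrite divr_ge0// ltW.
  exists ((t / vol K `^ (p^-1 - q^-1)) *: theta); last first.
    by rewrite scalerA mulrC divfK// gt_eqF.
  exists theta, (t / vol K `^ (p^-1 - q^-1)); split => //.
  rewrite fourier_mean_radial_ge//.
  move: tp; rewrite fourier_mean_radial_ge//; set T := t * vol K `^ (- p^-1) => Tp.
  have -> : t / vol K `^ (p^-1 - q^-1) * vol K `^ (- q^-1) = T.
    by rewrite -powRN -mulrA powV opprB addrAC subrr add0r.
  have [mphi phi_bound] := phi_bounded theta.
  have [T0|T0] := leP T 0.
    rewrite (_ : T = 0) ?powR0 ?gt_eqF// ?mulr0 ?mul0r.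
      by apply: integral_ge0 => r _; rewrite lee_fin mulr_ge0 ?powR_ge0 ?phi0.
    by apply/eqP; rewrite eq_le T0 mulr_ge0// powR_ge0.
  exact: (bounded_moment_mono mphi phi_bound p_gt0 (ltW ltpq) T0 Tp).
Qed.
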